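(* Let $a<0$, $c<0$, $a_2>0$, $c_2>0$, $b>0$, $b_2>0$, let $0<|\omega|<\min\left\{1,\frac{-a}{b},\frac{-c}{b},\frac{a_2}{b_2},\frac{c_2}{b_2}\right\}$, and let $F:\mathbb{R}^4\to\mathbb{R}$ be $C^2$ with $F(0)=0$ satisfying conditions (a), (b), (c) of the context. Let $(\psi_0,v_0)\in X$ satisfy $P_\omega(\psi_0,v_0)=0$ and $J_\omega(\psi_0,v_0)=S(\omega)$. Then $(\psi_0,v_0)$ is a weak solution of the traveling-wave system, i.e. $J_\omega'(\psi_0,v_0)=0$ in the dual of $X$.
   Context: $X=H^2(\mathbb{R})\times H^2(\mathbb{R})$. For $(\psi,v)\in X$: $I_1(\psi,v)=\int_{\mathbb R}[\psi^2-c(\psi')^2+c_2(\psi'')^2+v^2-a(v')^2+a_2(v'')^2]\,dx$, $I_2(\psi,v)=\int_{\mathbb R}(\psi v+b\psi'v'+b_2\psi''v'')\,dx$, $I_\omega=I_1-2\omega I_2$. $F:\mathbb{R}^4\to\mathbb{R}$ is $C^2$, $F(0)=0$, $G(w)=w\cdot\nabla F(w)$. Conditions: (a) there is $p>0$ with $w\cdot\nabla G(w)\ge(p+2)G(w)$ for all $w\in\mathbb{R}^4$; (b) there exist $0<q_1\le q_2<\infty$, $C>0$ with $|D^2F(w)|\le C(|w|^{q_1}+|w|^{q_2})$; (c) there exist $u,v\in H^2(\mathbb{R})$ with $\int_{\mathbb R}F(u,u',v,v')\,dx>0$. $K(\psi,v)=\int F(\psi,\psi',v,v')\,dx$, $N(\psi,v)=\int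 G(\psi,\psi',v,v')\,dx$, $J_\omega=\tfrac12I_\omega-K$, $P_\omega=I_\omega-N$, $\mathcal M_\omega=\{P_\omega=0\}$, $S(\omega)=\inf\{J_\omega(\psi,v):(\psi,v)\in\mathcal M_\omega\setminus\{0\}\}$. Weak solutions of the traveling-wave equations of the higher-order Boussinesq system (with $b=d$, $b_2=d_2$) are, by definition, critical points of $J_\omega$ on $X$. *)

(* Defs.v *)
From HB Require Import structures.
From mathcomp Require Import all_boot all_order all_algebra.
From mathcomp Require Import all_classical all_reals all_analysis.
Set Implicit Arguments. Unset Strict Implicit. Unset Printing Implicit Defensive.
Import Order.TTheory GRing.Theory Num.Theory.
Import numFieldNormedType.Exports.
Local Open Scope classical_set_scope.
Local Open Scope ring_scope.

Section Defs.
Variable R : realType.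
Local Notation mu := (@lebesgue_measure R).

Definition intR (f : R -> R) : R := Rintegral mu setT f.

Definition L2 (f : R -> R) : Prop :=
  measurable_fun setT f /\ mu.-integrable setT (fun x => (f x ^+ 2)%:E).

Definition test_fun (phi : R -> R) : Prop :=
  (forall (n : nat) (x : R), derivable (derive1n n phi) x 1) /\
  exists M : R, forall x, M < `|x| -> phi x = 0.

Definition weak_deriv (f g : R -> R) : Prop :=
  forall phi, test_fun phi ->
    intR (fun x => f x * derive1 phi x) = - intR (fun x => g x * phi x).

Definition H2 (u u1 u2 : R -> R) : Prop :=
  L2 u /\ L2 u1 /\ L2 u2 /\ weak_deriv u u1 /\ weak_deriv u1 u2.

(* An element (psi, v) of X = H^2 x H^2, carried together with chosen
   representatives of the weak derivatives. *)
Record Xrep := mkX { ps : R -> R; ps1 : R -> R; ps2 : R -> R;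
                     vv : R -> R; vv1 : R -> R; vv2 : R -> R }.

Definition inX (z : Xrep) : Prop :=
  H2 (ps z) (ps1 z) (ps2 z) /\ H2 (vv z) (vv1 z) (vv2 z).

Definition nonzeroX (z : Xrep) : Prop :=
  ~ ((\forall x \ae mu, ps z x = 0) /\ (\forall x \ae mu, vv z x = 0)).

Definition Xaxpy (z : Xrep) (t : R) (h : Xrep) : Xrep :=
  mkX (fun x => ps z x + t * ps h x) (fun x => ps1 z x + t * ps1 h x)
      (fun x => ps2 z x + t * ps2 h x) (fun x => vv z x + t * vv h x)
      (fun x => vv1 z x + t * vv1 h x) (fun x => vv2 z x + t * vv2 h x).

Definition I1 (a c a2 c2 : R) (z : Xrep) : R :=
  intR (fun x => ps z x ^+ 2 - c * ps1 z x ^+ 2 + c2 * ps2 z x ^+ 2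
                 + vv z x ^+ 2 - a * vv1 z x ^+ 2 + a2 * vv2 z x ^+ 2).

Definition I2 (b b2 : R) (z : Xrep) : R :=
  intR (fun x => ps z x * vv z x + b * ps1 z x * vv1 z x + b2 * ps2 z x * vv2 z x).

Definition Iom (a c a2 c2 b b2 om : R) (z : Xrep) : R :=
  I1 a c a2 c2 z - 2 * om * I2 b b2 z.

Definition vec4 (x0 x1 x2 x3 : R) : 'rV[R]_4 :=
  \row_(i < 4) nth 0 [:: x0; x1; x2; x3] i.

Definition e4 (i : 'I_4) : 'rV[R]_4 := delta_mx 0 i.

Definition pd (F : 'rV[R]_4 -> R) (i : 'I_4) (w : 'rV[R]_4) : R := 'D_(e4 i) F w.

Definition C2 (F : 'rV[R]_4 -> R) : Prop :=
  (forall i w, derivable F w (e4 i)) /\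
  (forall i j w, derivable (pd F i) w (e4 j)) /\
  (forall i, continuous (pd F i)) /\
  (forall i j, continuous (pd (pd F i) j)).

Definition enorm (w : 'rV[R]_4) : R := Num.sqrt (\sum_(i < 4) w 0 i ^+ 2).

Definition Gf (F : 'rV[R]_4 -> R) (w : 'rV[R]_4) : R := \sum_(i < 4) w 0 i * pd F i w.

Definition wgrad (H : 'rV[R]_4 -> R) (w : 'rV[R]_4) : R := \sum_(i < 4) w 0 i * pd H i w.

Definition cond_a (F : 'rV[R]_4 -> R) : Prop :=
  exists p : R, 0 < p /\ forall w, wgrad (Gf F) w >= (p + 2) * Gf F w.

(* |D^2 F(w)| <= C (|w|^q1 + |w|^q2), with the Hessian measured entrywise *)
Definition cond_b (F : 'rV[R]_4 -> R) : Prop :=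
  exists q1 q2 C : R, 0 < q1 /\ q1 <= q2 /\ 0 < C /\
    forall w i j, `|pd (pd F i) j w| <= C * (enorm w `^ q1 + enorm w `^ q2).

Definition Kf (F : 'rV[R]_4 -> R) (z : Xrep) : R :=
  intR (fun x => F (vec4 (ps z x) (ps1 z x) (vv z x) (vv1 z x))).

Definition Nf (F : 'rV[R]_4 -> R) (z : Xrep) : R :=
  intR (fun x => Gf F (vec4 (ps z x) (ps1 z x) (vv z x) (vv1 z x))).

Definition cond_c (F : 'rV[R]_4 -> R) : Prop :=
  exists z, inX z /\ Kf F z > 0.

Definition Jom (a c a2 c2 b b2 om : R) (F : 'rV[R]_4 -> R) (z : Xrep) : R :=
  Iom a c a2 c2 b b2 om z / 2 - Kf F z.

Definition Pom (a c a2 c2 b b2 om : R) (F : 'rV[R]_4 -> R) (z : Xrep) : R :=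
  Iom a c a2 c2 b b2 om z - Nf F z.

Definition Som (a c a2 c2 b b2 om : R) (F : 'rV[R]_4 -> R) : \bar R :=
  ereal_inf [set (Jom a c a2 c2 b b2 om F z)%:E |
             z in [set z | inX z /\ nonzeroX z /\ Pom a c a2 c2 b b2 om F z = 0]].

Definition critical (a c a2 c2 b b2 om : R) (F : 'rV[R]_4 -> R) (z : Xrep) : Prop :=
  forall h, inX h ->
    is_derive (0 : R) (1 : R) (fun t : R => Jom a c a2 c2 b b2 om F (Xaxpy z t h)) 0.

End Defs.

(* Main.v *)
(* Write s z + t h for the rescaled and perturbed minimizer z.  Elements of H^2 have
   essentially bounded first-order jets (test the weak derivative against a primitive
   of a mean-zero bump, then use Lebesgue differentiation), so the functional
   J is C^{1,1} along the plane spanned by z and h: grad F is Lipschitz on bounded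
   sets by (b) and vanishes at 0 by (a).

   If z <> 0, then I_omega is coercive, so N(z) = I(z) > 0, and integrating (a) along
   rays gives G(e^s w) >= e^{(p+2)s} G(w) for s >= 0 and <= for s <= 0.  Hence P(s z)
   is positive for s < 1 and negative for s > 1, and J(s z) <= J(z).  For small t the
   intermediate value theorem yields s_t near 1 with P(s_t z + t h) = 0, and
     J(s_t z) <= J(z) <= J(s_t z + t h) = J(s_t z) + t J'(z)h + O(t^2 + |t| |s_t - 1|).
   Both signs of t give J'(z)h = 0 without Lagrange multipliers.  If z = 0, all weak
   derivatives vanish and J'(0) = 0 because grad F(0) = 0. *)
Require Import Defs.
From HB Require Import structures.
From mathcomp Require Import all_boot all_order all_algebra.
From mathcomp Require Import all_classical all_reals all_analysis.
From mathcomp Require Import measurable_realfun ring lra.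
Import Order.TTheory GRing.Theory Num.Theory.
Import numFieldNormedType.Exports.
Local Open Scope classical_set_scope.
Local Open Scope ring_scope.

Set Implicit Arguments.
Unset Strict Implicit.
Unset Printing Implicit Defensive.

(** * Differential calculus on row vectors from partial derivatives *)

Section Calculus.
Context {R : realType}.

(** [G] already spends one of the two derivatives of [F] that (b) controls, so [P] is used only as a
    functional that is Lipschitz along lines. The scaling [s_t] is therefore obtained without the
    implicit function theorem: it need be neither unique nor differentiable in [t], and no rate for
    [s_t - 1] is available. The inequality [J(s z) <= J(z)] removes the effect of the rescaling
    altogether, and the remaining error [|t| |s_t - 1|] only has to be small compared with [|t|].
    The minimizer can be compared only with nonzero members of the Nehari set, so the competitor
    must also be shown not to vanish. Every property of the functionals is reduced to a pointwise
    inequality on jets with right-hand side a multiple of the squared Euclidean norm, which is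
    integrable. The Sobolev input is the essential bound on jets, which confines these inequalities
    to a bounded box. Rays are parametrized by [e^s] because the radial derivative is then exactly
    [w . grad], so (a) becomes a linear differential inequality in [s]. *)

Lemma is_derive_line {V : normedModType R} (H : V -> R) (y v : V) (a l : R) :
  is_derive (y + a *: v) v H l -> is_derive a (1 : R) (fun t : R => H (y + t *: v)) l.
Proof.
have E : (fun h : R => h^-1 *: (H (h *: v + (y + a *: v)) - H (y + a *: v)))
   = (fun h : R => h^-1 *: (H (y + (h *: (1 : R) + a) *: v) - H (y + a *: v))).
  apply/funext => h; congr (_ *: (H _ - _)).
  by rewrite addrCA -scalerDl /GRing.scale /= mulr1.
move=> [d1 d2]; split; first by move: d1; rewrite /derivable /= E.
by rewrite -d2 /derive /= E.
Qed.

(** The absolute values cover [b < a] as well, since increments of both signs occur later. *)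
Lemma mean_value (f df : R -> R) (a b : R) :
  (forall x : R, is_derive x (1 : R) f (df x)) ->
  exists c, `|c - a| <= `|b - a| /\ f b - f a = df c * (b - a).
Proof.
move=> fd.
have fc : continuous f.
  move=> x; apply: differentiable_continuous.
  by apply/derivable1_diffP; case: (fd x).
have fw A : {within A, continuous f} by apply: continuous_subspaceT.
have [ab|ba] := leP a b.
  have [c /itvP cab E] := MVT_segment ab (fun x _ => fd x) (fw _).
  exists c; split => //; rewrite !ger0_norm ?subr_ge0 ?cab //.
  by rewrite lerD2r cab.
have [c /itvP cab E] := MVT_segment (ltW ba) (fun x _ => fd x) (fw _).
exists c; split; last by rewrite -[LHS]opprB E -mulrN opprB.
by rewrite !ler0_norm ?subr_le0 ?cab // ?(ltW ba) // !opprB lerD2l lerN2 cab.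
Qed.

Lemma derive_ge0_le (f df : R -> R) (a b : R) :
  (forall x : R, is_derive x (1 : R) f (df x)) -> a <= b ->
  (forall x, a <= x <= b -> 0 <= df x) -> f a <= f b.
Proof.
move=> fd ab d0.
have fw : {within `[a, b], continuous f}.
  apply: continuous_subspaceT => x; apply: differentiable_continuous.
  by apply/derivable1_diffP; case: (fd x).
have [c] := MVT_segment ab (fun x _ => fd x) fw.
rewrite in_itv /= => cab E.
by rewrite -subr_ge0 E mulr_ge0 ?subr_ge0 // d0.
Qed.

(** Coordinatewise regularity, the form in which [C2] provides it for [F] and for each [pd F i]. *)
Definition C1 (H : 'rV[R]_4 -> R) : Prop :=
  (forall i w, derivable H w (e4 R i)) /\ (forall i, continuous (pd H i)).

Lemma C1_coord_mvt H (y : 'rV[R]_4) k a : C1 H ->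
  exists th, `|th| <= `|a| /\
    H (y + a *: e4 R k) - H y = a * pd H k (y + th *: e4 R k).
Proof.
move=> [dH _].
have fd (x : R) : is_derive x (1 : R) (fun t : R => H (y + t *: e4 R k)) (pd H k (y + x *: e4 R k)).
  by apply: is_derive_line; apply: derivableP.
have [c [cb E]] := @mean_value _ _ 0 a fd.
exists c; move: cb E; rewrite !subr0 scale0r addr0 => cb ->; split => //.
by rewrite mulrC.
Qed.

(** Corners of the staircase path from [0] to [h] that switches on one coordinate at a time. *)
Definition trunc_row (k : nat) (h : 'rV[R]_4) : 'rV[R]_4 :=
  \row_i (if (i < k)%N then h 0 i else 0).

Lemma trunc_rowS (k : 'I_4) h :
  trunc_row k.+1 h = trunc_row k h + h 0 k *: e4 R k.
Proof.
apply/rowP => i; rewrite !mxE /= ltnS.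
have [->|ne] := eqVneq i k; first by rewrite leqnn ltnn mulr1 add0r.
by rewrite mulr0 addr0 leq_eqVlt (inj_eq val_inj) (negbTE ne).
Qed.

Lemma cvg_norm_bound {V : normedModType R} (f : R -> V) (w : V) (C : R) :
  (forall t, t != 0 -> `|t| <= 1 -> `|f t - w| <= C * `|t|) -> f t @[t --> 0^'] --> w.
Proof.
move=> fb; apply/cvgrPdist_le => e e0.
have C0 : 0 < `|C| + 1 by rewrite ltr_wpDl.
near=> t; rewrite distrC (le_trans (fb t _ _)) //.
- by near: t; exact: nbhs_dnbhs_neq.
- by near: t; apply: (@dnbhs0_le R R).
apply: (@le_trans _ _ ((`|C| + 1) * `|t|)).
  by rewrite ler_wpM2r // (le_trans (ler_norm _)) // lerDl.
rewrite -ler_pdivlMl //; near: t.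
apply: (@dnbhs0_le R R); by rewrite mulr_gt0 ?invr_gt0.
Unshelve. all: by end_near. Qed.

(** The increment is telescoped along the staircase. Each stair is a one-variable mean value whose
    intermediate point tends to [w], so continuity of the partial derivatives gives the limit;
    [choice] makes that point a function of [t]. *)
Lemma C1_is_derive H (w h : 'rV[R]_4) : C1 H ->
  is_derive w h H (\sum_(i < 4) h 0 i * pd H i w).
Proof.
move=> c1; have [dH cH] := c1.
pose y k (t : R) := w + t *: trunc_row k h.
have cv (k : 'I_4) :
    t^-1 *: (H (y k.+1 t) - H (y k t)) @[t --> 0^'] --> h 0 k * pd H k w.
  have /choice [th thP] : forall t, exists th, `|th| <= `|t * h 0 k| /\
      H (y k.+1 t) - H (y k t) = t * h 0 k * pd H k (y k t + th *: e4 R k).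
    move=> t; have [th [b E]] := C1_coord_mvt (y k t) k (t * h 0 k) c1.
    exists th; split=> //; rewrite -E; congr (H _ - _).
    by rewrite /y trunc_rowS scalerDr scalerA addrA.
  have c : y k t + th t *: e4 R k @[t --> 0^'] --> w.
    apply: (@cvg_norm_bound _ _ _ (`|trunc_row k h| + `|h 0 k| * `|e4 R k|)) => t _ _.
    have -> : y k t + th t *: e4 R k - w = t *: trunc_row k h + th t *: e4 R k.
      by rewrite /y -[w + _ + _]addrA [LHS]addrC addKr.
    rewrite (le_trans (ler_normD _ _)) // !normrZ.
    rewrite mulrDl lerD //; first by rewrite mulrC.
    have [b _] := thP t.
    by rewrite mulrAC -normrM ler_wpM2r // [h 0 k * t]mulrC.
  have c' := cvg_comp _ _ c (cH k w).
  have c2 : h 0 k * pd H k (y k t + th t *: e4 R k) @[t --> 0^'] --> h 0 k * pd H k w.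
    by apply: cvgM; [exact: cvg_cst|exact: c'].
  apply: cvg_trans c2; apply: near_eq_cvg; near=> t.
  have t0 : t != 0 by near: t; exact: nbhs_dnbhs_neq.
  rewrite /=; have [_ ->] := thP t.
  by rewrite /GRing.scale /= !mulrA mulVf // mul1r.
have cs : t^-1 *: (H (t *: h + w) - H w) @[t --> 0^'] -->
    \sum_(i < 4) h 0 i * pd H i w.
  have -> : (fun t : R => t^-1 *: (H (t *: h + w) - H w)) =
      (fun t => \sum_(k < 4) t^-1 *: (H (y k.+1 t) - H (y k t))).
    apply/funext => t; rewrite -scaler_sumr; congr (_ *: _).
    rewrite -(big_mkord xpredT (fun k => H (y k.+1 t) - H (y k t))) telescope_sumr //.
    congr (H _ - H _); rewrite /y addrC.
      congr (_ + _ *: _); apply/rowP => i; rewrite !mxE ltn_ord //.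
    by rewrite (_ : trunc_row 0 h = 0) ?scaler0 ?add0r //; apply/rowP => i; rewrite !mxE.
  by apply: cvg_big => [|k _]; [exact: add_continuous|exact: cv].
split; first by apply/cvg_ex; exists (\sum_(i < 4) h 0 i * pd H i w).
exact/cvg_lim.
Unshelve. all: by end_near. Qed.

Lemma C1_is_derive_line H (w h : 'rV[R]_4) (t : R) : C1 H ->
  is_derive t (1 : R) (fun t : R => H (w + t *: h)) (\sum_(i < 4) h 0 i * pd H i (w + t *: h)).
Proof. by move=> c1; apply: is_derive_line; apply: C1_is_derive. Qed.

(** By the mean value theorem on the segment from [w] to [v], the increment pairs [v - w], which
    tends to 0, with the gradient at a point tending to [w]. *)
Lemma C1_continuous H : C1 H -> continuous H.
Proof.
move=> c1 w; have [dH cH] := c1.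
have /choice [th thP] : forall v, exists th : R, `|th| <= 1 /\
    H v - H w = \sum_(i < 4) (v - w) 0 i * pd H i (w + th *: (v - w)).
  move=> v; have [c [cb E]] := @mean_value _ _ 0 1 (fun t => C1_is_derive_line w (v - w) t c1).
  exists c; move: cb E; rewrite !subr0 normr1 scale1r scale0r addr0 mulr1.
  by rewrite [w + (v - w)]addrC subrK.
have c : w + th v *: (v - w) @[v --> w] --> w.
  apply/(@cvgrPdist_le _ _ _ _ (nbhs_filter w)) => e e0; near=> v.
  rewrite opprD addNKr normrN normrZ (@le_trans _ _ (1 * `|v - w|)) //.
    by rewrite ler_wpM2r //; case: (thP v).
  rewrite mul1r distrC; near: v; exact: cvgr_dist_le.
have s0 : \sum_(i < 4) (v - w) 0 i * pd H i (w + th v *: (v - w)) @[v --> w] --> (0 : R).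
  have E0 : \sum_(i < 4) (w - w) 0 i * pd H i w = 0.
    by rewrite subrr big1 // => i _; rewrite mxE mul0r.
  rewrite -[X in _ --> X]E0.
  apply: (@cvg_big _ _ _ _ _ _ _ (nbhs w) _ _ _ (nbhs_filter w)) => [|i _].
    exact: add_continuous.
  apply: (@cvgM _ _ (nbhs w) (nbhs_filter w)); last exact: (cvg_comp _ _ c (cH i w)).
  have := @coord_continuous R _ _ 0 i (w - w); apply: cvg_comp.
  by apply: (@cvgB _ _ _ (nbhs w) (nbhs_filter w)); [exact: cvg_id|exact: cvg_cst].
apply/(@subr_cvg0 _ _ _ _ (nbhs_filter w)).
rewrite (_ : (fun v => _) = fun v => \sum_(i < 4) (v - w) 0 i * pd H i (w + th v *: (v - w))) //.
by apply/funext => v; case: (thP v).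
Unshelve. all: by end_near. Qed.

End Calculus.

(** * Condition (a) along rays *)

Section ScalingOfNonlinearity.
Context {R : realType}.
Implicit Types (F H : 'rV[R]_4 -> R) (w h : 'rV[R]_4).

Lemma C2_C1 F : C2 F -> C1 F.
Proof. by move=> [dF [_ [cF _]]]. Qed.

Lemma C2_C1_pd F i : C2 F -> C1 (pd F i).
Proof. by move=> [_ [ddF [_ cF]]]; split => j; [exact: ddF|exact: cF]. Qed.

Lemma is_derive_coord w h i : is_derive w h (fun w : 'rV[R]_4 => w 0 i) (h 0 i).
Proof.
have E : (fun t : R => t^-1 *: ((t *: h + w) 0 i - w 0 i)) @ 0^' --> h 0 i.
  apply: (@cvg_trans _ (cst (h 0 i) @ (0^' : set_system R))); last exact: cvg_cst.
  apply: near_eq_cvg; near=> t.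
  have t0 : t != 0 by near: t; exact: nbhs_dnbhs_neq.
  by rewrite !mxE addrK /GRing.scale /= mulKf.
split; first by apply/cvg_ex; exists (h 0 i).
exact/cvg_lim.
Unshelve. all: by end_near. Qed.

Lemma is_derive_Gf F w j : C2 F ->
  is_derive w (e4 R j) (Gf F) (pd F j w + \sum_(i < 4) w 0 i * pd (pd F i) j w).
Proof.
move=> cF; have [dF [ddF _]] := cF.
have -> : Gf F = \sum_(i < 4) ((fun w : 'rV[R]_4 => w 0 i) * pd F i).
  by apply/funext => v; rewrite /Gf fct_sumE.
apply: is_derive_eq.
  apply: is_derive_sum => i.
  apply: is_deriveM; [exact: is_derive_coord|exact: derivableP].
rewrite big_split /= addrC; congr (_ + _).
rewrite (bigD1 j) //= big1 ?addr0 => [|i ne].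
  by rewrite mxE !eqxx /GRing.scale /= mulr1.
by rewrite mxE (negbTE ne) andbF /GRing.scale /= mulr0.
Qed.

Lemma Gf_C1 F : C2 F -> C1 (Gf F).
Proof.
move=> cF; have [dF [ddF [cpd cpd2]]] := cF.
split => j; first by move=> w; case: (is_derive_Gf w j cF).
have -> : pd (Gf F) j =
    (fun w => pd F j w + \sum_(i < 4) w 0 i * pd (pd F i) j w).
  by apply/funext => w; rewrite /pd; have [_ ->] := is_derive_Gf w j cF.
move=> w; apply: (@cvgD _ _ _ (nbhs w) (nbhs_filter w)); first exact: cpd.
apply: (@cvg_big _ _ _ _ _ _ _ (nbhs w) _ _ _ (nbhs_filter w)) => [|i _].
  exact: add_continuous.
apply: (@cvgM _ _ (nbhs w) (nbhs_filter w)); last exact: cpd2.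
exact: coord_continuous.
Qed.

Lemma is_derive_exp_scale H w (s : R) : C1 H ->
  is_derive s (1 : R) (fun s : R => H (expR s *: w)) (wgrad H (expR s *: w)).
Proof.
move=> c1.
have dl := C1_is_derive_line 0 w (expR s) c1.
have -> : (fun s : R => H (expR s *: w)) = (fun t : R => H (0 + t *: w)) \o expR.
  by apply/funext => t /=; rewrite add0r.
apply: (@is_derive_eq _ _ _ _ _ _ _ _ (is_derive1_comp dl (is_derive_expR s))).
rewrite add0r /wgrad mulr_suml; apply: eq_bigr => i _.
by rewrite mxE mulrC mulrA.
Qed.

(** Let [g] be the gradient of [F] at 0. The Hessian term in the gradient of [G] drops at 0, so [G]
    has gradient [g] there too. Dividing (a) at [t g] by [t > 0] and letting [t] tend to 0 gives
    [- (p + 1) |g|^2 >= 0]. *)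
Lemma grad0 F : C2 F -> cond_a F -> forall i, pd F i 0 = 0.
Proof.
move=> cF [p [p0 ca]].
pose g : 'rV[R]_4 := \row_i pd F i 0.
pose k (t : R) := \sum_(i < 4) g 0 i * pd (Gf F) i (0 + t *: g)
  - (p + 2) * \sum_(i < 4) g 0 i * pd F i (0 + t *: g).
have [_ cG] := Gf_C1 cF; have [_ [_ [cpd _]]] := cF.
have cl : (0 + t *: g) @[t --> (0 : R)] --> (0 + 0 *: g).
  by apply: cvgD; [exact: cvg_cst|exact: (@scalel_continuous R _ g 0)].
have ck : k t @[t --> (0 : R)] --> k 0.
  have cs (h : 'I_4 -> 'rV[R]_4 -> R) : (forall i, continuous (h i)) ->
      \sum_(i < 4) g 0 i * h i (0 + t *: g) @[t --> (0 : R)] -->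
      \sum_(i < 4) g 0 i * h i (0 + 0 *: g).
    move=> ch; apply: cvg_big => [|i _]; first exact: add_continuous.
    by apply: cvgM; [exact: cvg_cst|exact: (cvg_comp _ _ cl (ch i _))].
  apply: cvgB; first exact: (cs (pd (Gf F)) cG).
  by apply: cvgM; [exact: cvg_cst|exact: (cs (pd F) cpd)].
have k0 : 0 <= k 0.
  rewrite leNgt; apply/negP => kn.
  have kt (t : R) : 0 < t -> 0 <= k t.
    move=> t0; have := ca (t *: g); rewrite -subr_ge0 /wgrad {2}/Gf.
    have -> : \sum_(i < 4) (t *: g) 0 i * pd (Gf F) i (t *: g)
       - (p + 2) * (\sum_(i < 4) (t *: g) 0 i * pd F i (t *: g)) = t * k t.
      have E (f : 'I_4 -> R) : \sum_(i < 4) (t *: g) 0 i * f i = t * \sum_(i < 4) g 0 i * f i.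
        by rewrite mulr_sumr; apply: eq_bigr => i _; rewrite mxE mulrA.
      by rewrite /k add0r !E; ring.
    by rewrite pmulr_rge0.
  have nk : \forall t \near (0 : R), k t < 0 by apply: (cvgr_lt _ ck).
  have [e e0 eP] := nk; have := eP (e / 2); rewrite /= sub0r normrN.
  have e2 : 0 < e / 2 by rewrite divr_gt0.
  rewrite gtr0_norm // => /(_ _); rewrite ltr_pdivrMr // ltr_pMr // ltr1n => /(_ isT).
  by rewrite ltNge kt.
have kE : k 0 = - (p + 1) * \sum_(i < 4) g 0 i ^+ 2.
  rewrite /k scale0r addr0.
  have -> : \sum_(i < 4) g 0 i * pd (Gf F) i 0 = \sum_(i < 4) g 0 i ^+ 2.
    apply: eq_bigr => i _; rewrite expr2 [in LHS]/pd.
    have [_ ->] := is_derive_Gf 0 i cF.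
    by rewrite big1 ?addr0 ?mxE // => j _; rewrite mxE mul0r.
  have -> : \sum_(i < 4) g 0 i * pd F i 0 = \sum_(i < 4) g 0 i ^+ 2.
    by apply: eq_bigr => i _; rewrite expr2 mxE.
  ring.
have S0 : \sum_(i < 4) g 0 i ^+ 2 <= 0.
  by move: k0; rewrite kE; nra.
have S1 : \sum_(i < 4) g 0 i ^+ 2 = 0.
  by apply/eqP; rewrite eq_le S0 sumr_ge0 // => i _; rewrite sqr_ge0.
move=> i; have : g 0 i ^+ 2 = 0.
  exact: (psumr_eq0P (fun i _ => sqr_ge0 (g 0 i)) S1).
by move/eqP; rewrite sqrf_eq0 mxE => /eqP.
Qed.

Lemma is_derive_expRZ (k s : R) :
  is_derive s (1 : R) (fun s => expR (k * s)) (k * expR (k * s)).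
Proof.
have d : is_derive s (1 : R) (k \*: (id : R -> R)) k.
  by apply: is_derive_eq; rewrite /GRing.scale /= mulr1.
apply: (is_derive_eq (is_derive1_comp (is_derive_expR (k * s)) d)).
by rewrite mulrC.
Qed.

(* This is condition (a) integrated along rays. *)
Lemma G_exp_scale F (q : R) w : C2 F ->
  (forall w, wgrad (Gf F) w >= q * Gf F w) ->
  {homo (fun s => expR (- q * s) * Gf F (expR s *: w)) : s t / s <= t}.
Proof.
move=> cF ca s t st.
apply: (@derive_ge0_le _ (fun s => expR (- q * s) * Gf F (expR s *: w))
  (fun s => expR (- q * s) * wgrad (Gf F) (expR s *: w)
   + Gf F (expR s *: w) * (- q * expR (- q * s)))) => // [x|x _].
  exact: (is_deriveM (is_derive_expRZ (- q) x) (is_derive_exp_scale w x (Gf_C1 cF))).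
have := ca (expR x *: w).
set A := wgrad _ _; set B := Gf _ _ => AB.
have -> : expR (- q * x) * A + B * (- q * expR (- q * x))
  = expR (- q * x) * (A - q * B) by ring.
by rewrite mulr_ge0 ?expR_ge0 // subr_ge0.
Qed.

Lemma G_exp_ge F (q : R) w s : C2 F ->
  (forall w, wgrad (Gf F) w >= q * Gf F w) -> 0 <= s ->
  expR (q * s) * Gf F w <= Gf F (expR s *: w).
Proof.
move=> cF ca s0; have := G_exp_scale w cF ca s0.
rewrite mulr0 expR0 mul1r scale1r mulNr expRN => H.
by rewrite -ler_pdivlMl ?expR_gt0.
Qed.

Lemma G_exp_le F (q : R) w s : C2 F ->
  (forall w, wgrad (Gf F) w >= q * Gf F w) -> s <= 0 ->
  Gf F (expR s *: w) <= expR (q * s) * Gf F w.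
Proof.
move=> cF ca s0; have := G_exp_scale w cF ca s0.
rewrite mulr0 expR0 mul1r scale1r mulNr expRN => H.
by rewrite -ler_pdivrMl ?expR_gt0.
Qed.

Lemma min_at_zero (f df : R -> R) :
  (forall x : R, is_derive x (1 : R) f (df x)) ->
  (forall x, 0 <= x -> 0 <= df x) -> (forall x, x <= 0 -> df x <= 0) ->
  forall x, f 0 <= f x.
Proof.
move=> fd dp dn x; have [x0|x0] := leP 0 x.
  by apply: (derive_ge0_le fd x0) => y /andP[y0 _]; exact: dp.
rewrite -lerN2.
apply: (@derive_ge0_le _ (- f) (fun x => - df x) _ _ (fun y => is_deriveN (fd y)) (ltW x0)) => y.
by move=> /andP[_ y0]; rewrite oppr_ge0 dn.
Qed.

(** The difference of the two sides has derivative [G(e^s w) - e^(q s) G(w)] in [s], which has the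
    sign of [s] by the ray inequalities; hence its minimum is at [s = 0]. The pointwise sign of
    [G(w)] is left free: only its integral is known to be positive. *)
Lemma F_exp_ge F (q : R) w s : C2 F -> 0 < q ->
  (forall w, wgrad (Gf F) w >= q * Gf F w) ->
  F w + Gf F w * ((expR (q * s) - 1) / q) <= F (expR s *: w).
Proof.
move=> cF q0 ca.
have fd (x : R) : is_derive x (1 : R)
    (fun s => F (expR s *: w) - (Gf F w / q) * expR (q * s))
    (Gf F (expR x *: w) - expR (q * x) * Gf F w).
  apply: (is_derive_eq (is_deriveB (is_derive_exp_scale w x (C2_C1 cF))
    (is_deriveZ (Gf F w / q) (is_derive_expRZ q x)))).
  by rewrite /GRing.scale /= mulrA divfK ?gt_eqF // mulrC.
have := min_at_zero fd _ _ s.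
rewrite mulr0 expR0 mulr1 scale1r => H.
have {}H : F w - Gf F w / q <= F (expR s *: w) - Gf F w / q * expR (q * s).
  apply: H => x x0; first by rewrite subr_ge0; exact: G_exp_ge.
  by rewrite subr_le0; exact: G_exp_le.
rewrite -subr_ge0; rewrite -subr_ge0 in H.
by apply: le_trans H _; rewrite le_eqVlt; apply/orP; left; apply/eqP; ring.
Qed.

(** The quotient is nondecreasing in [q] for [s] of either sign. With [q = p + 2] this sets the
    growth of [K] along a ray against the quadratic growth of [I / 2]. *)
Lemma exp_quotient_ge (q s : R) : 2 <= q ->
  (expR (2 * s) - 1) / 2 <= (expR (q * s) - 1) / q.
Proof.
move=> q2; have q0 : 0 < q by lra.
have fd (x : R) : is_derive x (1 : R)
    (fun s => q^-1 * expR (q * s) - 2^-1 * expR (2 * s))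
    (expR (q * x) - expR (2 * x)).
  apply: (is_derive_eq (is_deriveB (is_deriveZ q^-1 (is_derive_expRZ q x))
    (is_deriveZ 2^-1 (is_derive_expRZ 2 x)))).
  by rewrite /GRing.scale /= !mulKf ?gt_eqF.
have := min_at_zero fd _ _ s.
rewrite !mulr0 expR0 !mulr1 => H.
have {}H : q^-1 - 2^-1 <= q^-1 * expR (q * s) - 2^-1 * expR (2 * s).
  by apply: H => x x0; rewrite ?subr_ge0 ?subr_le0 ler_expR; nra.
by lra.
Qed.

End ScalingOfNonlinearity.

(** * Estimates for [F], its gradient and [G] on bounded boxes *)

Section LocalBounds.
Context {R : realType}.
Implicit Types (F : 'rV[R]_4 -> R) (w h : 'rV[R]_4) (M : R).

Definition entries_le M w : Prop := forall i, `|w 0 i| <= M.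
Definition l1 w : R := \sum_(i < 4) `|w 0 i|.
(** Final error bounds are stated with [sq]: it is integrable on the jet of an element of [X],
    whereas [l1] of the jet need not be. *)
Definition sq w : R := \sum_(i < 4) w 0 i ^+ 2.

Lemma l1_ge0 w : 0 <= l1 w. Proof. exact: sumr_ge0. Qed.

Lemma sq_ge0 w : 0 <= sq w.
Proof. by apply: sumr_ge0 => i _; exact: sqr_ge0. Qed.

Lemma l1Z (t : R) w : l1 (t *: w) = `|t| * l1 w.
Proof.
by rewrite /l1 mulr_sumr; apply: eq_bigr => i _; rewrite mxE normrM.
Qed.

Lemma l1_sqr_le w : l1 w ^+ 2 <= 4 * sq w.
Proof.
rewrite /l1 /sq !big_ord_recl !big_ord0 !addr0.
set a := w 0 _; set b := w 0 _; set c := w 0 _; set d := w 0 _.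
rewrite -(real_normK (num_real a)) -(real_normK (num_real b)).
rewrite -(real_normK (num_real c)) -(real_normK (num_real d)).
move: `|a| `|b| `|c| `|d| => {}a {}b {}c {}d.
have := sqr_ge0 (a - b); have := sqr_ge0 (a - c); have := sqr_ge0 (a - d).
have := sqr_ge0 (b - c); have := sqr_ge0 (b - d); have := sqr_ge0 (c - d).
rewrite !expr2; lra.
Qed.

Lemma l1M_le w h : l1 w * l1 h <= 2 * (sq w + sq h).
Proof.
have := l1_sqr_le w; have := l1_sqr_le h; have := sqr_ge0 (l1 w - l1 h).
by rewrite !expr2; lra.
Qed.

Lemma entries_leD M M' (t : R) w h : `|t| <= 1 ->
  entries_le M w -> entries_le M' h -> entries_le (M + M') (w + t *: h).
Proof.
move=> t1 bw bh i; rewrite !mxE (le_trans (ler_normD _ _)) // lerD //.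
by rewrite normrM (le_trans _ (bh i)) // ler_piMl.
Qed.

Lemma entries_leW M M' w : M <= M' -> entries_le M w -> entries_le M' w.
Proof. by move=> MM bw i; rewrite (le_trans (bw i)). Qed.

Lemma entries_leZ M (t : R) w : 0 <= t <= 2 -> entries_le M w -> entries_le (2 * M) (t *: w).
Proof.
move=> /andP[t0 t2] bw i; rewrite mxE normrM ler_pM // ger0_norm //.
Qed.

Lemma dot_le h (f : 'I_4 -> R) (B : R) :
  (forall i, `|f i| <= B) -> `|\sum_(i < 4) h 0 i * f i| <= l1 h * B.
Proof.
move=> fB; rewrite (le_trans (ler_norm_sum _ _ _)) // /l1 mulr_suml.
by apply: ler_sum => i _; rewrite normrM ler_wpM2l.
Qed.

Lemma hessian_bound F M : cond_b F ->
  exists L, 0 <= L /\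
    forall w, entries_le M w -> forall i j, `|pd (pd F i) j w| <= L.
Proof.
move=> [q1 [q2 [C [q10 [q12 [C0 hb]]]]]].
(* [K] is [2 |M|], the Euclidean norm of a corner of the box. *)
pose K := Num.sqrt (\sum_(i < 4) M ^+ 2).
exists (C * (K `^ q1 + K `^ q2)); split.
  by rewrite mulr_ge0 ?(ltW C0) // addr_ge0 ?powR_ge0.
move=> w bw i j; rewrite (le_trans (hb w i j)) //.
have K0 : 0 <= K by exact: sqrtr_ge0.
have wK : enorm w <= K.
  rewrite /enorm ler_wsqrtr // ler_sum // => k _.
  by rewrite -(real_normK (num_real (w 0 k))) lerXn2r // ?nnegrE // (le_trans _ (bw k)).
rewrite ler_wpM2l ?(ltW C0) // lerD // ge0_ler_powR ?nnegrE ?sqrtr_ge0 //.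
  exact: ltW.
exact: le_trans (ltW q10) q12.
Qed.

Lemma grad_lipschitz F M : C2 F -> cond_b F ->
  exists L, 0 <= L /\ forall w w', entries_le M w -> entries_le M w' ->
    forall i, `|pd F i w' - pd F i w| <= L * l1 (w' - w).
Proof.
(* The intermediate point is [w + c (w' - w)], where [w' - w] has entries up to [M + M]. *)
move=> cF cb; have [L [L0 hL]] := hessian_bound (M + (M + M)) cb.
exists L; split => // w w' bw bw' i.
have [c [c1]] := @mean_value R _ _ 0 1
  (fun t => C1_is_derive_line w (w' - w) t (C2_C1_pd i cF)).
rewrite scale1r scale0r addr0 subr0 mulr1 [w + (w' - w)]addrC subrK => ->.
rewrite mulrC; apply: dot_le => j; apply: hL; apply: entries_leD => //.
  by move: c1; rewrite !subr0 normr1.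
by move=> k; rewrite !mxE (le_trans (ler_normB _ _)) // lerD.
Qed.

Lemma grad_bound F M : C2 F -> cond_a F -> cond_b F -> 0 <= M ->
  exists L, 0 <= L /\ forall w, entries_le M w ->
    forall i, `|pd F i w| <= L * l1 w.
Proof.
move=> cF ca cb M0; have [L [L0 hL]] := grad_lipschitz M cF cb.
exists L; split => // w bw i; have := hL 0 w _ bw i.
by rewrite (grad0 cF ca) !subr0; apply => k; rewrite mxE normr0.
Qed.

(** A first-order mean value suffices: the remainder is [t] times the pairing of [h] with a gradient
    increment, and the gradient is Lipschitz on the box. The constant is the same for all [w] and
    [h] in the box, which allows integration in [x]. *)
Lemma F_taylor F M : C2 F -> cond_b F -> 0 <= M ->
  exists C, 0 <= C /\ forall w h (t : R), entries_le M w -> entries_le M h -> `|t| <= 1 ->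
    `|F (w + t *: h) - F w - t * \sum_(i < 4) h 0 i * pd F i w| <= C * t ^+ 2 * sq h.
Proof.
move=> cF cb M0; have [L [L0 hL]] := grad_lipschitz (M + M) cF cb.
exists (4 * L); split; first by rewrite mulr_ge0.
move=> w h t bw bh t1.
have [c [ct]] := @mean_value R _ _ 0 t (fun t => C1_is_derive_line w h t (C2_C1 cF)).
rewrite !subr0 in ct *; rewrite scale0r addr0 => ->.
rewrite mulrC -mulrBr -sumrB normrM.
rewrite (eq_bigr (fun i => h 0 i * (pd F i (w + c *: h) - pd F i w))); last first.
  by move=> i _; rewrite mulrBr.
have c1 : `|c| <= 1 by rewrite (le_trans ct).
have : `|\sum_(i < 4) h 0 i * (pd F i (w + c *: h) - pd F i w)| <= l1 h * (L * (`|t| * l1 h)).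
  apply: dot_le => i; rewrite (le_trans (hL w (w + c *: h) _ _ i)) //.
  - by apply: entries_leW bw; rewrite lerDl.
  - exact: entries_leD.
  rewrite [w + _]addrC addrK l1Z ler_wpM2l // ler_wpM2r //; exact: l1_ge0.
have := l1_sqr_le h; have := l1_ge0 h; have := sq_ge0 h.
rewrite -(real_normK (num_real t)) => s0 l0 l2 H.
apply: le_trans (ler_wpM2l (normr_ge0 t) H) _.
have -> : `|t| * (l1 h * (L * (`|t| * l1 h))) = (L * `|t| ^+ 2) * l1 h ^+ 2 by ring.
have -> : 4 * L * `|t| ^+ 2 * sq h = (L * `|t| ^+ 2) * (4 * sq h) by ring.
by rewrite ler_wpM2l // mulr_ge0 // sqr_ge0.
Qed.

Lemma F_quadratic F M : C2 F -> cond_a F -> cond_b F -> F 0 = 0 -> 0 <= M ->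
  exists C, 0 <= C /\ forall w, entries_le M w -> `|F w| <= C * sq w.
Proof.
move=> cF ca cb F0 M0; have [C [C0 hC]] := F_taylor cF cb M0.
exists C; split => // w bw; have := hC 0 w 1 _ bw _.
rewrite F0 add0r scale1r big1 => [|i _]; last by rewrite (grad0 cF ca) mulr0.
rewrite mulr0 !subr0 expr1n mulr1; apply; last by rewrite normr1.
by move=> i; rewrite mxE normr0.
Qed.

Lemma grad_dot_bound F M : C2 F -> cond_a F -> cond_b F -> 0 <= M ->
  exists C, 0 <= C /\ forall w h, entries_le M w ->
    `|\sum_(i < 4) h 0 i * pd F i w| <= C * (sq w + sq h).
Proof.
move=> cF ca cb M0; have [L [L0 hL]] := grad_bound cF ca cb M0.
exists (2 * L); split; first by rewrite mulr_ge0.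
move=> w h bw; rewrite (le_trans (dot_le h (fun i => hL w bw i))) //.
have := ler_wpM2l L0 (l1M_le w h).
rewrite [2 * L]mulrC -[L * 2 * _]mulrA; apply: le_trans.
by rewrite mulrCA [l1 h * _]mulrC.
Qed.

(** Moves the gradient from the rescaled point [s w] back to [w]; this is the origin of the error
    [|t| |s - 1|]. *)
Lemma grad_scale F M : C2 F -> cond_b F -> 0 <= M ->
  exists C, 0 <= C /\ forall w h (s : R), entries_le M w -> 0 <= s <= 2 ->
    `|\sum_(i < 4) h 0 i * pd F i (s *: w) - \sum_(i < 4) h 0 i * pd F i w|
      <= C * `|s - 1| * (sq w + sq h).
Proof.
move=> cF cb M0; have [L [L0 hL]] := grad_lipschitz (2 * M) cF cb.
exists (2 * L); split; first by rewrite mulr_ge0.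
move=> w h s bw s2; rewrite -sumrB.
rewrite (eq_bigr (fun i => h 0 i * (pd F i (s *: w) - pd F i w))); last first.
  by move=> i _; rewrite mulrBr.
rewrite (@le_trans _ _ (l1 h * (L * (`|s - 1| * l1 w)))) //.
  apply: dot_le => i; rewrite (le_trans (hL w (s *: w) _ _ i)) //.
  - by apply: entries_leW bw; rewrite ler_peMl // ler1n.
  - exact: entries_leZ.
  by rewrite -[X in _ *: _ - X]scale1r -scalerBl l1Z.
have -> : l1 h * (L * (`|s - 1| * l1 w)) = L * `|s - 1| * (l1 w * l1 h) by ring.
have -> : 2 * L * `|s - 1| * (sq w + sq h) = L * `|s - 1| * (2 * (sq w + sq h)) by ring.
by rewrite ler_wpM2l ?l1M_le // mulr_ge0.
Qed.

(** Product rule in increments: the change of the point pairs with the gradient, which is at most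
    linear because it vanishes at 0, and the old point pairs with the change of the gradient. *)
Lemma G_lipschitz F M : C2 F -> cond_a F -> cond_b F -> 0 <= M ->
  exists C, 0 <= C /\ forall w h (t : R), entries_le M w -> entries_le M h -> `|t| <= 1 ->
    `|Gf F (w + t *: h) - Gf F w| <= C * `|t| * (sq w + sq h).
Proof.
move=> cF ca cb M0.
have MM0 : 0 <= M + M by rewrite addr_ge0.
have [L [L0 hL]] := grad_lipschitz (M + M) cF cb.
have [L' [L'0 hL']] := grad_bound cF ca cb MM0.
exists (6 * L' + 2 * L); split; first by rewrite addr_ge0 ?mulr_ge0.
move=> w h t bw bh t1.
have bwt := entries_leD t1 bw bh.
have bw2 : entries_le (M + M) w by apply: entries_leW bw; rewrite lerDl.
have -> : Gf F (w + t *: h) - Gf F w =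
    t * (\sum_(i < 4) h 0 i * pd F i (w + t *: h)) +
    \sum_(i < 4) w 0 i * (pd F i (w + t *: h) - pd F i w).
  rewrite /Gf mulr_sumr -sumrB -big_split; apply: eq_bigr => i _ /=.
  by rewrite !mxE; ring.
have h1 := dot_le h (fun i => hL' _ bwt i).
have h2 := dot_le w (fun i => hL _ _ bw2 bwt i).
have e : w + t *: h - w = t *: h by rewrite [w + _]addrC addrK.
rewrite e l1Z in h2.
have lt : l1 (w + t *: h) <= l1 w + l1 h.
  rewrite /l1 -big_split ler_sum // => i _; rewrite !mxE.
  by rewrite (le_trans (ler_normD _ _)) // lerD // normrM ler_piMl.
rewrite (le_trans (ler_normD _ _)) // normrM.
(* The 6 is 2 from [l1M_le] plus 4 from [l1_sqr_le]. *)
have A : l1 h * (L' * l1 (w + t *: h)) <= 6 * L' * (sq w + sq h).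
  rewrite (@le_trans _ _ (L' * (l1 w * l1 h + l1 h * l1 h))) //.
    have := ler_wpM2l (l1_ge0 h) (ler_wpM2l L'0 lt).
    by move/le_trans; apply; rewrite le_eqVlt; apply/orP; left; apply/eqP; ring.
  have -> : 6 * L' * (sq w + sq h) = L' * (6 * (sq w + sq h)) by ring.
  rewrite ler_wpM2l //.
  by have := l1M_le w h; have := l1_sqr_le h; have := sq_ge0 w; rewrite expr2; lra.
have B : l1 w * (L * (`|t| * l1 h)) <= `|t| * (2 * L * (sq w + sq h)).
  have -> : l1 w * (L * (`|t| * l1 h)) = `|t| * L * (l1 w * l1 h) by ring.
  have -> : `|t| * (2 * L * (sq w + sq h)) = `|t| * L * (2 * (sq w + sq h)) by ring.
  by rewrite ler_wpM2l ?l1M_le // mulr_ge0.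
have -> : (6 * L' + 2 * L) * `|t| * (sq w + sq h) =
  `|t| * (6 * L' * (sq w + sq h)) + `|t| * (2 * L * (sq w + sq h)) by ring.
rewrite lerD ?(le_trans h2) // ler_wpM2l // (le_trans h1) //.
Qed.

End LocalBounds.

(** * Construction of smooth compactly supported bumps *)

Section SmoothFunctions.
Context {R : realType}.
Implicit Types (f g : R -> R) (p q : {poly R}).

Definition smooth f : Prop := forall n (x : R), derivable (derive1n n f) x 1.

(** Finite order makes closure under products an induction, with [CkW] lowering the order of the
    undifferentiated factor. The index is shifted: [Ck n] provides [n + 1] successive
    derivatives. *)
Fixpoint Ck n f : Prop :=
  (forall x : R, derivable f x 1) /\ if n is m.+1 then Ck m (derive1 f) else True.

Lemma smooth_Ck f : smooth f <-> forall n, Ck n f.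
Proof.
split=> [sf n|cf n x].
  elim: n f sf => [|n IH] f sf /=; split=> //; try exact: (sf 0%N).
  by apply: IH => m x; rewrite -derive1Sn.
elim: n f cf => [|n IH] f cf; first by have [] := cf 0%N.
by rewrite derive1Sn; apply: IH => m; have [] := cf m.+1.
Qed.

Lemma Ck_derivable n f x : Ck n f -> derivable f x 1.
Proof. by case: n => [|n] []. Qed.

Lemma CkW n f : Ck n.+1 f -> Ck n f.
Proof.
elim: n f => [|n IH] f [df c]; first by split.
by split => //; exact: IH.
Qed.

Lemma CkD n f g : Ck n f -> Ck n g -> Ck n (f + g).
Proof.
elim: n f g => [|n IH] f g [df cf] [dg cg].
  by split; [move=> x; exact: derivableD|].
split=> [x|]; first exact: derivableD.
rewrite (_ : derive1 (f + g) = derive1 f + derive1 g); first exact: IH.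
by apply/funext => x; rewrite derive1E deriveD // /= -!derive1E.
Qed.

Lemma CkM n f g : Ck n f -> Ck n g -> Ck n (f * g).
Proof.
elim: n f g => [|n IH] f g Cf Cg.
  by split=> // x; apply: derivableM; apply: Ck_derivable; eassumption.
have [df cf] := Cf; have [dg cg] := Cg; split=> [x|]; first exact: derivableM.
rewrite (_ : derive1 (f * g) = f * derive1 g + g * derive1 f).
  by apply: CkD; apply: IH => //; exact: CkW.
by apply/funext => x; rewrite derive1E deriveM // /GRing.scale /= -!derive1E.
Qed.

Lemma Ck_cst n (k : R) : Ck n (cst k).
Proof.
elim: n k => [|n IH] k; split=> //.
rewrite (_ : derive1 (cst k) = cst 0) //.
by apply/funext => x; rewrite derive1_cst.
Qed.

Lemma is_derive_affine (f : R -> R) (k l x : R) : derivable f (k * x + l) 1 ->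
  is_derive x (1 : R) (fun x => f (k * x + l)) (k * derive1 f (k * x + l)).
Proof.
move=> df; have d : is_derive x (1 : R) ((k \*: (id : R -> R)) + cst l) k.
  by apply: is_derive_eq; rewrite /GRing.scale /= mulr1 addr0.
have df' : is_derive (((k \*: (id : R -> R)) + cst l) x) (1 : R) f (derive1 f (k * x + l)).
  by rewrite derive1E; exact: derivableP.
by apply: (is_derive_eq (is_derive1_comp df' d)); rewrite mulrC.
Qed.

Lemma Ck_affine n f (k l : R) : Ck n f -> Ck n (fun x => f (k * x + l)).
Proof.
elim: n f => [|n IH] f [df cf].
  by split; [move=> x; case: (is_derive_affine (df (k * x + l)))|].
split=> [x|]; first by case: (is_derive_affine (df (k * x + l))).
rewrite (_ : derive1 _ = cst k * (fun x => derive1 f (k * x + l))).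
  by apply: CkM; [exact: Ck_cst|exact: IH].
apply/funext => x; rewrite derive1E.
by have [_ ->] := is_derive_affine (df (k * x + l)).
Qed.

Lemma smoothD f g : smooth f -> smooth g -> smooth (f + g).
Proof. by move=> /smooth_Ck cf /smooth_Ck cg; apply/smooth_Ck => n; exact: CkD. Qed.

Lemma smoothM f g : smooth f -> smooth g -> smooth (f * g).
Proof. by move=> /smooth_Ck cf /smooth_Ck cg; apply/smooth_Ck => n; exact: CkM. Qed.

Lemma smooth_cst (k : R) : smooth (cst k).
Proof. by apply/smooth_Ck => n; exact: Ck_cst. Qed.

Lemma smooth_affine f (k l : R) : smooth f -> smooth (fun x => f (k * x + l)).
Proof. by move=> /smooth_Ck cf; apply/smooth_Ck => n; exact: Ck_affine. Qed.

Lemma smooth_primitive f g :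
  (forall x : R, derivable f x 1) -> derive1 f = g -> smooth g -> smooth f.
Proof. by move=> df fg sg [|n] x; [exact: df|rewrite derive1Sn fg]. Qed.

Lemma smooth_continuous f : smooth f -> continuous f.
Proof.
move=> sf x; apply: differentiable_continuous.
by apply/derivable1_diffP; exact: (sf 0%N).
Qed.

Lemma smooth_derive1 f : smooth f -> smooth (derive1 f).
Proof. by move=> sf n x; rewrite -derive1Sn. Qed.

Lemma poly_le_exp q : exists C, forall y, 0 <= y -> `|q.[y]| <= C * expR y.
Proof.
have mono n (y : R) : 0 <= y -> y ^+ n <= n`!%:R * expR y.
  move=> y0; case: n => [|n].
    rewrite expr0 fact0 mul1r; have := expR_ge1Dx y; lra.
  have := expR_ge1Dxn n y0.
  have f0 : (0 : R) < n.+1`!%:R by rewrite ltr0n fact_gt0.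
  move=> H; rewrite -ler_pdivrMl // mulrC; lra.
exists (\sum_(i < size q) `|q`_i| * i`!%:R) => y y0.
rewrite horner_coef (le_trans (ler_norm_sum _ _ _)) // mulr_suml ler_sum // => i _.
rewrite normrM -mulrA ler_wpM2l // ger0_norm ?exprn_ge0 //; exact: mono.
Qed.

(** The classical flat function is [flat 1]. Admitting a polynomial in [1/x] makes the family closed
    under differentiation, so smoothness of all its members follows by one induction. *)
Definition flat p (x : R) : R := if 0 < x then p.[x^-1] * expR (- x^-1) else 0.

(** Exponential decay beats the polynomial [p * 'X^2] in [1/x]. Quadratic smallness makes the
    difference quotient at 0 of order [x], so the derivative there is 0. *)
Lemma flat_le_sqr p : exists C, forall x, `|flat p x| <= C * x ^+ 2.
Proof.
have [C hC] := poly_le_exp (p * 'X^2).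
have C0 : 0 <= C.
  by have := hC 0 (lexx _); rewrite expR0 mulr1; apply: le_trans.
exists C => x; rewrite /flat; case: ltP => [x0|_]; last first.
  by rewrite normr0 mulr_ge0 // sqr_ge0.
have := hC x^-1; rewrite invr_ge0 (ltW x0) => /(_ isT).
rewrite hornerM hornerXn normrM [`|x^-1 ^+ 2|]ger0_norm ?sqr_ge0 // exprVn => H.
rewrite normrM (ger0_norm (expR_ge0 _)) expRN ler_pdivrMr ?expR_gt0 //.
rewrite mulrAC -ler_pdivrMr ?exprn_gt0 //.
Qed.

Lemma flat_is_derive p (x : R) :
  is_derive x (1 : R) (flat p) (flat ((p - p^`()) * 'X^2) x).
Proof.
have [x0|x0|->] := ltgtP x 0.
- have -> : flat ((p - p^`()) * 'X^2) x = 0 by rewrite /flat ltNge (ltW x0).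
  apply: (near_eq_is_derive _ (is_derive_cst (0 : R) x 1)).
  near=> y; rewrite /flat ifF //; apply/negbTE; rewrite -leNgt ltW //.
  by near: y; exact: lt_nbhsl.
- have x1 : x != 0 by rewrite gt_eqF.
  have di : is_derive x (1 : R) (fun y : R => y^-1) (- x ^- 2).
    have := @is_deriveV _ id x 1 1 x1 (is_derive_id x 1).
    by rewrite /GRing.scale /= mulr1.
  have d1 := is_derive1_comp (is_derive_poly p x^-1) di.
  have d2 := @is_derive1_comp _ expR (fun y => - y^-1) x _ _
    (is_derive_expR (- x^-1)) (is_deriveN di).
  apply: (near_eq_is_derive _ (is_derive_eq (is_deriveM d1 d2) _)).
    near=> y; rewrite /flat ifT //.
    by near: y; exact: lt_nbhsr.
  rewrite /GRing.scale /= /flat x0 hornerM hornerXn hornerD hornerN opprK exprVn.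
  ring.
- have [C hC] := flat_le_sqr p.
  have f0 q : flat q 0 = 0 by rewrite /flat ltxx.
  rewrite f0.
  have E : (fun h : R => h^-1 *: (flat p (h *: 1 + 0) - flat p 0)) @ 0^' --> (0 : R).
    apply: (@cvg_norm_bound _ _ _ _ C) => h h0 _.
    rewrite f0 !subr0 addr0 /GRing.scale /= mulr1 normrM.
    rewrite normfV ler_pdivrMl ?normr_gt0 // (le_trans (hC h)) //.
    by rewrite -(real_normK (num_real h)) expr2 mulrCA.
  split; first by apply/cvg_ex; exists 0.
  exact/cvg_lim.
Unshelve. all: by end_near. Qed.

Lemma flat_smooth p : smooth (flat p).
Proof.
move=> n; elim: n p => [|n IH] p x; first by case: (flat_is_derive p x).
rewrite derive1Sn (_ : derive1 (flat p) = flat ((p - p^`()) * 'X^2)) //.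
by apply/funext => y; rewrite derive1E; have [_ ->] := flat_is_derive p y.
Qed.

Lemma flat1E (x : R) : flat 1 x = if 0 < x then expR (- x^-1) else 0.
Proof. by rewrite /flat hornerC mul1r. Qed.

Lemma flat1_itv (x : R) : 0 <= flat 1 x <= 1.
Proof.
rewrite flat1E; case: ifP => [x0|_]; last by rewrite lexx ler01.
by rewrite expR_ge0 expR_le1 oppr_le0 invr_ge0 ltW.
Qed.

(* Smooth approximations of the indicator function of ]a, b[. *)
Definition bump (n : nat) (a b x : R) : R :=
  flat 1 (n.+1%:R * x + - (n.+1%:R * a)) * flat 1 (- n.+1%:R * x + n.+1%:R * b).

Lemma bump_smooth n a b : smooth (bump n a b).
Proof. by apply: smoothM; apply: smooth_affine; exact: flat_smooth. Qed.

Lemma bump_itv n a b x : 0 <= bump n a b x <= 1.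
Proof.
rewrite /bump; have /andP[A0 A1] := flat1_itv (n.+1%:R * x + - (n.+1%:R * a)).
have /andP[B0 B1] := flat1_itv (- n.+1%:R * x + n.+1%:R * b).
by rewrite mulr_ge0 //= mulr_ile1.
Qed.

Lemma bump_out n a b x : ~~ (a < x < b) -> bump n a b x = 0.
Proof.
have n0 : (0 : R) < n.+1%:R by rewrite ltr0n.
rewrite negb_and -!leNgt /bump !flat1E => /orP[xa|bx].
  by rewrite ifF ?mul0r //; apply/negbTE; rewrite -leNgt subr_le0 ler_pM2l.
rewrite [X in _ * X]ifF ?mulr0 //; apply/negbTE.
by rewrite -leNgt mulNr addrC subr_le0 ler_pM2l.
Qed.

Lemma bump_in n a b x : a < x < b ->
  bump n a b x = expR (- (n.+1%:R^-1 * ((x - a)^-1 + (b - x)^-1))).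
Proof.
move=> /andP[ax xb].
have n0 : (0 : R) < n.+1%:R by rewrite ltr0n.
rewrite /bump [- _ * x + _]addrC mulNr -!mulrBr !flat1E !pmulr_rgt0 // !subr_gt0 ax xb.
by rewrite -expRD [in RHS]mulrDr [in RHS]opprD !invfM.
Qed.

(** Inside the interval the exponent is a fixed number divided by [n + 1]; outside, endpoints
    included, every bump vanishes. *)
Lemma cvg_bump a b x : bump n a b x @[n --> \oo] --> (\1_(`]a, b[%classic : set R) x : R).
Proof.
rewrite indicE; case: (boolP (a < x < b)) => axb.
  have -> : (x \in `]a, b[%classic) by rewrite inE /= in_itv.
  rewrite (_ : (fun n => bump n a b x) =
      (fun n => expR (- (n.+1%:R^-1 * ((x - a)^-1 + (b - x)^-1))))); last first.
    by apply/funext => n; exact: bump_in.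
  rewrite -[X in _ --> X]expR0; apply: continuous_cvg; first exact: continuous_expR.
  rewrite -[X in _ --> X]oppr0; apply: cvgN.
  rewrite -[X in _ --> X](mul0r ((x - a)^-1 + (b - x)^-1)).
  by apply: cvgM; [exact: cvg_harmonic|exact: cvg_cst].
have -> : (x \in `]a, b[%classic) = false.
  by apply/negbTE; rewrite notin_setE /= in_itv /=; exact/negP.
rewrite (_ : (fun n => _) = cst 0); first exact: cvg_cst.
by apply/funext => n; exact: bump_out.
Qed.

Lemma test_bump n a b : test_fun (bump n a b).
Proof.
split; first exact: bump_smooth.
exists (`|a| + `|b|) => x hx; apply: bump_out; apply/negP => /andP[ax xb].
move: hx; rewrite ltNge => /negP; apply.
have [x0|x0] := leP 0 x.
  by rewrite ger0_norm // (le_trans (ltW xb)) // (le_trans (ler_norm _)) // lerDr.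
rewrite ltr0_norm // (@le_trans _ _ (- a)) ?lerN2 ?(ltW ax) //.
by rewrite (le_trans (ler_norm _)) // normrN lerDl.
Qed.

End SmoothFunctions.

(** * Real-valued Lebesgue integrals and measurability of compositions *)

Section Integration.
Context {R : realType}.
Local Notation mu := (@lebesgue_measure R).
Implicit Types (f g h : R -> R).

Lemma ae_imp (P Q : R -> Prop) : (forall x, P x -> Q x) ->
  (\forall x \ae mu, P x) -> \forall x \ae mu, Q x.
Proof. by move=> PQ; apply: filterS => //; exact: (ae_filter_ringOfSetsType mu). Qed.

Lemma ae_and (P Q : R -> Prop) : (\forall x \ae mu, P x) ->
  (\forall x \ae mu, Q x) -> \forall x \ae mu, P x /\ Q x.
Proof. by move=> p q; apply: filterI p q; exact: (ae_filter_ringOfSetsType mu). Qed.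

Definition integ f : Prop := mu.-integrable setT (EFin \o f).

Lemma integ_measurable f : integ f -> measurable_fun setT f.
Proof. by move=> /integrableP[/measurable_EFinP]. Qed.

Lemma integ_le f g : measurable_fun setT f -> (forall x, `|f x| <= g x) ->
  integ g -> integ f.
Proof.
move=> mf fg; apply: le_integrable => //; first exact/measurable_EFinP.
by move=> x _ /=; rewrite lee_fin (le_trans (fg x)) // ler_norm.
Qed.

Lemma integD f g : integ f -> integ g -> integ (fun x => f x + g x).
Proof. by move=> If Ig; apply: (integrableD _ If Ig). Qed.

Lemma integZ (k : R) f : integ f -> integ (fun x => k * f x).
Proof. by move=> If; apply: (integrableZl _ k If). Qed.

Lemma integB f g : integ f -> integ g -> integ (fun x => f x - g x).
Proof.
move=> If Ig; have := integD If (integZ (-1) Ig).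
by congr (integ _); apply/funext => x; rewrite mulN1r.
Qed.

Lemma integ_norm f : integ f -> integ (fun x => `|f x|).
Proof. exact: integrable_norm. Qed.

Lemma intRD f g : integ f -> integ g -> intR (fun x => f x + g x) = intR f + intR g.
Proof. exact: RintegralD. Qed.

Lemma intRB f g : integ f -> integ g -> intR (fun x => f x - g x) = intR f - intR g.
Proof. exact: RintegralB. Qed.

Lemma intRZ (k : R) f : integ f -> intR (fun x => k * f x) = k * intR f.
Proof. exact: RintegralZl. Qed.

Lemma intR0 : intR (fun=> 0 : R) = 0.
Proof. by rewrite /intR Rintegral_cst // mul0r. Qed.

Lemma intR_le f g : integ f -> integ g -> (forall x, f x <= g x) -> intR f <= intR g.
Proof. by move=> If Ig fg; apply: le_Rintegral. Qed.

Lemma intR_norm_le f g : integ f -> integ g -> (forall x, `|f x| <= g x) ->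
  `|intR f| <= intR g.
Proof.
move=> If Ig fg; rewrite (le_trans (le_normr_Rintegral _ If)) //.
by apply: intR_le => //; exact: integ_norm.
Qed.

Lemma eq_intR f g : (forall x, f x = g x) -> intR f = intR g.
Proof. by move=> fg; congr intR; exact/funext. Qed.

Lemma eq_integ f g : (forall x, f x = g x) -> integ f -> integ g.
Proof. by move=> fg; rewrite (funext fg). Qed.

Lemma ae_eq_intR f g : measurable_fun setT f -> measurable_fun setT g ->
  (\forall x \ae mu, f x = g x) -> intR f = intR g.
Proof.
move=> mf mg fg; rewrite /intR /Rintegral; congr fine.
apply: ae_eq_integral => //; [exact/measurable_EFinP|exact/measurable_EFinP|].
by apply: ae_imp fg => x /= ->.
Qed.

Lemma ae_eq_integ f g : measurable_fun setT f -> measurable_fun setT g ->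
  (\forall x \ae mu, f x = g x) -> integ f -> integ g.
Proof.
move=> mf mg fg /integrableP[_ fy]; apply/integrableP.
split; first exact/measurable_EFinP.
rewrite (_ : (\int[mu]_x `|(EFin \o g) x|)%E = (\int[mu]_x `|(EFin \o f) x|)%E) //.
apply: ae_eq_integral => //.
- by apply: measurableT_comp => //; exact/measurable_EFinP.
- by apply: measurableT_comp => //; exact/measurable_EFinP.
by apply: ae_imp fg => x /= ->.
Qed.

Lemma intR_eq0_ae f : integ f -> (forall x, 0 <= f x) -> intR f <= 0 ->
  \forall x \ae mu, f x = 0.
Proof.
move=> If f0 le0.
have E : (\int[mu]_x `|(EFin \o f) x|)%E = 0%E.
  have -> : (\int[mu]_x `|(EFin \o f) x|)%E = (\int[mu]_x (f x)%:E)%E.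
    by apply: eq_integral => x _ /=; rewrite ger0_norm.
  have fin : (\int[mu]_x (f x)%:E)%E \is a fin_num by exact: integrable_fin_num.
  have ge0 : 0 <= intR f by exact: Rintegral_ge0.
  rewrite -(fineK fin); congr EFin; apply/eqP; rewrite eq_le; exact/andP.
have /ae_eq_integral_abs H := measurable_int mu If.
have := H mu measurableT; move=> [H1 _]; have := H1 E.
by apply: ae_imp => x /= /(_ I) [].
Qed.

Lemma L2_integ f : L2 f -> integ (fun x => f x ^+ 2).
Proof. by case. Qed.

Lemma integM f g : L2 f -> L2 g -> integ (fun x => f x * g x).
Proof.
move=> [mf If] [mg Ig].
apply: (@integ_le _ (fun x => f x ^+ 2 + g x ^+ 2)); last exact: integD.
  exact: measurable_funM.
move=> x; rewrite normrM.
rewrite -(real_normK (num_real (f x))) -(real_normK (num_real (g x))).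
move: `|f x| `|g x| => u v.
by have := sqr_ge0 (u - v); have := sqr_ge0 (u + v); rewrite !expr2; lra.
Qed.

Lemma L2_axpy f g (t : R) : L2 f -> L2 g -> L2 (fun x => f x + t * g x).
Proof.
move=> Lf Lg; have [mf If] := Lf; have [mg Ig] := Lg; split.
  by apply: measurable_funD => //; apply: measurable_funM.
have := integD (integD If (integZ (2 * t) (integM Lf Lg))) (integZ (t ^+ 2) Ig).
by apply: eq_integ => x /=; ring.
Qed.

(** Each preimage is a countable union of fibres of [k], so [v] may be arbitrary. *)
Lemma measurable_countable_values (K : countType) (k : R -> K) (v : K -> R) :
  (forall c, measurable [set x | k x = c]) -> measurable_fun setT (v \o k).
Proof.
move=> mk _ B mB; rewrite setTI.
rewrite (_ : _ @^-1` B = \bigcup_c ([set x | k x = c] `&` [set _ | B (v c)])).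
  apply: countable_bigcupT_measurable; first exact: countableP.
  move=> c; have [Bc|nBc] := pselect (B (v c)).
    rewrite (_ : [set _ | B (v c)] = setT) ?setIT //.
    by apply/seteqP; split.
  rewrite (_ : [set _ | B (v c)] = set0) ?setI0 //.
  by apply/seteqP; split.
apply/seteqP; split => [x Bx|x [c _ [/= <-]]] //.
by exists (k x).
Qed.

Lemma vec4E (a b c d : R) : vec4 a b c d =
  a *: e4 R 0 + b *: e4 R 1 + c *: e4 R 2%:R + d *: e4 R 3%:R.
Proof.
apply/rowP => i; rewrite !mxE /=.
by case: i => [[|[|[|[|i]]]] hi] //=; rewrite ?(mulr0, mulr1, addr0, add0r).
Qed.

Lemma floor_approx (y : R) :
  (Num.floor (n.+1%:R * y))%:~R / n.+1%:R @[n --> \oo] --> y.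
Proof.
apply/cvgrPdist_le => e e0.
have := @cvg_harmonic R; move/cvgrPdist_le => /(_ e e0); apply: filterS => n.
rewrite sub0r normrN ger0_norm ?harmonic_ge0 //; apply: le_trans.
have n0 : (0 : R) < n.+1%:R by rewrite ltr0n.
have /andP[l u] := floor_itv (n.+1%:R * y).
have -> : y - (Num.floor (n.+1%:R * y))%:~R / n.+1%:R =
    (n.+1%:R * y - (Num.floor (n.+1%:R * y))%:~R) / n.+1%:R.
  by rewrite mulrBl mulrAC mulfV ?gt_eqF // mul1r.
rewrite normrM normfV (gtr0_norm n0) -[harmonic n]mul1r ler_wpM2r ?invr_ge0 ?ltW //.
by rewrite ger0_norm ?subr_ge0 //; move: u; rewrite intrD => u; lra.
Qed.

Lemma measurable_floor_fiber f (n : nat) (k : int) : measurable_fun setT f ->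
  measurable [set x | Num.floor (n.+1%:R * f x) = k].
Proof.
move=> mf.
rewrite (_ : [set x | _] =
  setT `&` (fun x => n.+1%:R * f x) @^-1` [set` `[k%:~R, (k + 1)%:~R[%R]).
  have mg : measurable_fun setT (fun x => n.+1%:R * f x) by exact: measurable_funM.
  by apply: mg => //; exact: measurable_itv.
apply/seteqP; split => [x /= <-|x /= [_]].
  by split => //; rewrite in_itv /= floor_itv.
by rewrite in_itv /= => /floor_def.
Qed.

(** Rounding the four arguments down to multiples of [1/(n+1)] leaves countably many values, and
    continuity of [H] makes the original function a pointwise limit. No sigma-algebra on row vectors
    enters. *)
Lemma measurable_vec4 (H : 'rV[R]_4 -> R) (f0 f1 f2 f3 : R -> R) : continuous H ->
  measurable_fun setT f0 -> measurable_fun setT f1 ->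
  measurable_fun setT f2 -> measurable_fun setT f3 ->
  measurable_fun setT (fun x => H (vec4 (f0 x) (f1 x) (f2 x) (f3 x))).
Proof.
move=> cH m0 m1 m2 m3.
pose k n (f : R -> R) x := Num.floor (n.+1%:R * f x).
pose r n (c : int) : R := c%:~R / n.+1%:R.
apply: (@measurable_fun_cvg _ _ _ _ (fun n x =>
  H (vec4 (r n (k n f0 x)) (r n (k n f1 x)) (r n (k n f2 x)) (r n (k n f3 x))))).
  move=> n.
  have := @measurable_countable_values _
    (fun x => (k n f0 x, k n f1 x, k n f2 x, k n f3 x))
    (fun c => H (vec4 (r n c.1.1.1) (r n c.1.1.2) (r n c.1.2) (r n c.2))).
  apply => -[[[c0 c1] c2] c3].
  rewrite (_ : [set x | _] = [set x | k n f0 x = c0] `&` [set x | k n f1 x = c1]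
    `&` [set x | k n f2 x = c2] `&` [set x | k n f3 x = c3]).
    by do !apply: measurableI; exact: measurable_floor_fiber.
  by apply/seteqP; split => x /= [[[]]] => [|] -> -> -> ->.
move=> x _; apply: continuous_cvg; first exact: cH.
rewrite vec4E (_ : (fun n => _) = fun n => r n (k n f0 x) *: e4 R 0 +
  r n (k n f1 x) *: e4 R 1 + r n (k n f2 x) *: e4 R 2%:R + r n (k n f3 x) *: e4 R 3%:R).
  by do 3?[apply: cvgD]; apply: cvgZl; exact: floor_approx.
by apply/funext => n; rewrite vec4E.
Qed.

End Integration.

(** * From averages against bumps to almost everywhere bounds *)

Section Sobolev.
Context {R : realType}.
Local Notation mu := (@lebesgue_measure R).
Implicit Types (f g u : R -> R) (a b : R).

Definition ind (a b x : R) : R := \1_(`]a, b[%classic : set R) x.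

Lemma indE a b x : ind a b x = if a < x < b then 1 else 0.
Proof.
rewrite /ind indicE; case: (boolP (a < x < b)) => axb.
  by have -> : (x \in `]a, b[%classic) by rewrite inE /= in_itv.
have -> // : (x \in `]a, b[%classic) = false.
by apply/negbTE; rewrite notin_setE /= in_itv /=; exact/negP.
Qed.

Lemma integ_ind a b : integ (ind a b).
Proof. exact: integrable_indic_itv. Qed.

Lemma intR_ind a b : a <= b -> intR (ind a b) = b - a.
Proof.
move=> ab; rewrite /intR /Rintegral.
have -> : (\int[mu]_x (ind a b x)%:E)%E = mu (`]a, b[%classic : set R).
  by rewrite integral_indic // setIT.
rewrite lebesgue_measure_itv /= lte_fin.
by move: ab; rewrite le_eqVlt => /predU1P[->|->]; rewrite ?ltxx ?subrr.
Qed.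

Lemma measurable_ind a b : measurable_fun setT (ind a b).
Proof. exact: integ_measurable (integ_ind a b). Qed.

Lemma bump_le_ind n a b x : bump n a b x <= ind a b x.
Proof.
rewrite indE; case: ifP => axb; last by rewrite bump_out ?axb.
by have /andP[] := bump_itv n a b x.
Qed.

Lemma bump_ge0 n a b x : 0 <= bump n a b x.
Proof. by have /andP[] := bump_itv n a b x. Qed.

Lemma smooth_measurable f : smooth f -> measurable_fun setT f.
Proof. by move=> /smooth_continuous; exact: continuous_measurable_fun. Qed.

Lemma integ_bump n a b : integ (bump n a b).
Proof.
apply: (@integ_le R _ (ind a b) _ _ (integ_ind a b)).
  exact: (smooth_measurable (@bump_smooth R n a b)).
by move=> x; rewrite ger0_norm ?bump_ge0 // bump_le_ind.
Qed.

Lemma integM_ind f a b : L2 f -> integ (fun x => f x * ind a b x).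
Proof.
move=> [mf If]; apply: (@integ_le R _ (fun x => f x ^+ 2 + ind a b x)).
- by apply: measurable_funM => //; exact: measurable_ind.
- move=> x; rewrite normrM -(real_normK (num_real (f x))) indE.
  by case: ifP => _; rewrite ?normr1 ?normr0 ?mulr0 ?mulr1 ?addr0;
    have := sqr_ge0 (`|f x| - 1); have := sqr_ge0 `|f x|; rewrite !expr2; lra.
by apply: integD => //; exact: integ_ind.
Qed.

Lemma norm_le_ind_integ f g a b (B : R) : L2 f -> measurable_fun setT g -> 0 <= B ->
  (forall x, `|g x| <= B * ind a b x) ->
  integ (fun x => f x * g x).
Proof.
move=> Lf mg B0 gB; have [mf If] := Lf.
apply: (@integ_le R _ (fun x => B * `|f x * ind a b x|)).
- exact: measurable_funM.
- move=> x; rewrite !normrM mulrCA ler_wpM2l // (le_trans (gB x)) //.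
  by rewrite ler_wpM2l // ler_norm.
by apply: integZ; apply: integ_norm; exact: integM_ind.
Qed.

(** [|f| <= f^2 + 1] plays the part of the Cauchy-Schwarz inequality. The bound sees the interval
    only through its length, so it is uniform under translation. *)
Lemma intR_mul_le f g a b (B : R) : L2 f -> measurable_fun setT g -> 0 <= B ->
  a <= b -> (forall x, `|g x| <= B * ind a b x) ->
  `|intR (fun x => f x * g x)| <= B * (intR (fun x => f x ^+ 2) + (b - a)).
Proof.
move=> Lf mg B0 ab gB; have [mf If] := Lf.
have Ii := integ_ind a b.
rewrite -(intR_ind ab) -intRD // -intRZ; last exact: integD.
apply: intR_norm_le; first exact: (norm_le_ind_integ Lf mg B0 gB).
  by apply: integZ; exact: integD.
move=> x; rewrite normrM; apply: (@le_trans _ _ (`|f x| * (B * ind a b x))).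
  by rewrite ler_wpM2l.
rewrite mulrCA ler_wpM2l // -(real_normK (num_real (f x))) indE.
by case: ifP => _; rewrite ?mulr0 ?mulr1 ?addr0;
    have := sqr_ge0 (`|f x| - 1); have := sqr_ge0 `|f x|; rewrite !expr2; lra.
Qed.

Lemma cvg_intR_bump f a b : L2 f ->
  (fun n => intR (fun x => f x * bump n a b x)) @ \oo --> intR (fun x => f x * ind a b x).
Proof.
move=> Lf; have [mf If] := Lf.
have mfi : measurable_fun setT (fun x => f x * ind a b x).
  by apply: measurable_funM => //; exact: measurable_ind.
have mfb n : measurable_fun setT (fun x => f x * bump n a b x).
  by apply: measurable_funM => //; exact: (smooth_measurable (@bump_smooth R n a b)).
have cv : \forall x \ae mu, setT x ->
    (f x * bump n a b x)%:E @[n --> \oo] --> (f x * ind a b x)%:E.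
  apply: aeW => x _; apply: cvg_EFin; first exact: nearW.
  by apply: cvgM; [exact: cvg_cst|exact: cvg_bump].
have dom : \forall x \ae mu, forall n, setT x ->
    (`|(f x * bump n a b x)%:E| <= `|f x * ind a b x|%:E)%E.
  apply: aeW => x n _; rewrite /= lee_fin normrM [in leRHS]normrM ler_wpM2l //.
  rewrite (ger0_norm (bump_ge0 _ _ _ _)).
  exact: le_trans (bump_le_ind n a b x) (ler_norm _).
have [_ _ c] := @dominated_convergence _ _ _ mu setT measurableT
  (fun n x => (f x * bump n a b x)%:E) (fun x => (f x * ind a b x)%:E)
  (fun x => (`|f x * ind a b x|)%:E)
  (fun n => (measurable_EFinP _ _).2 (mfb n)) ((measurable_EFinP _ _).2 mfi)
  cv (integ_norm (integM_ind a b Lf)) dom.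
have := integM_ind a b Lf => Ifi.
apply: fine_cvg; rewrite fineK; first exact: c.
exact: integrable_fin_num.
Unshelve. all: by end_near. Qed.

Lemma interval_average_le f (C : R) a b : L2 f -> a < b -> 0 <= C ->
  (forall n, `|intR (fun x => f x * bump n a b x)| <= C * intR (bump n a b)) ->
  `|intR (fun x => f x * ind a b x)| <= C * (b - a).
Proof.
move=> Lf ab C0 fb.
apply: (cvgr_to_le (cvg_norm (cvg_intR_bump Lf))).
near=> n; apply: (le_trans (fb n)); rewrite ler_wpM2l // -(intR_ind (ltW ab)).
by apply: intR_le; [exact: integ_bump|exact: integ_ind|exact: bump_le_ind].
Unshelve. all: by end_near. Qed.

Lemma L2_locally_integrable f : L2 f -> locally_integrable setT f.
Proof.
move=> Lf; have [mf If] := Lf; split => //; first exact: openT.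
move=> K _ cK.
have [M [_ hM]] := compact_bounded cK.
pose B := `|M| + 1.
have MB : M < B by rewrite (le_lt_trans (ler_norm _)) // ltrDl.
have KB x : K x -> `|x| <= B by move=> Kx; apply: (hM _ MB).
(* [ind] is the indicator of an open interval and [K] may reach [B] or [- B], hence the margin 1. *)
have I1 : (\int[mu]_x `|f x * ind (- B - 1) (B + 1) x|%:E < +oo)%E.
  by have /integrableP[] := integM_ind (- B - 1) (B + 1) Lf.
apply: le_lt_trans I1.
have mK : measurable K by exact: compact_measurable.
rewrite integral_mkcond; apply: ge0_le_integral => //.
- by move=> x _; rewrite patchE; case: ifP => //; rewrite lee_fin.
- apply: (measurable_restrictT _ mK).1; apply/measurable_EFinP.
  by apply: measurableT_comp => //; exact: measurable_funS mf.
- apply/measurable_EFinP; apply: measurableT_comp => //.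
  by apply: measurable_funM => //; exact: measurable_ind.
move=> x _; rewrite patchE; case: ifP => [|_]; last by rewrite lee_fin.
rewrite inE => /KB; rewrite ler_norml => /andP[l u].
rewrite lee_fin indE ifT ?mulr1 //; apply/andP; split; lra.
Qed.

Lemma integral_ind f a b : L2 f ->
  (\int[mu]_(y in `]a, b[) (f y)%:E)%E = (intR (fun x => f x * ind a b x))%:E.
Proof.
move=> Lf; rewrite /intR /Rintegral fineK; last first.
  by apply: integrable_fin_num => //; exact: integM_ind.
rewrite [LHS]integral_mkcond; apply: eq_integral => x _.
rewrite patchE /ind indicE; case: ifP => _; by rewrite ?mulr1 ?mulr0.
Qed.

(** At a Lebesgue point, [f x] is the limit of averages over []x, x + 1/(n+1)[]. Only lengths up to
    1 are tested, because the bounds fed in come from comparison with a reference bump on a unit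
    interval. *)
Lemma ae_norm_le f (C : R) : L2 f -> 0 <= C ->
  (forall a b n, a < b <= a + 1 ->
    `|intR (fun x => f x * bump n a b x)| <= C * intR (bump n a b)) ->
  \forall x \ae mu, `|f x| <= C.
Proof.
move=> Lf C0 fb.
pose d n : R := harmonic n.
have d0 n : 0 < d n by exact: harmonic_gt0.
have d1 n : d n <= 1 by rewrite /d /harmonic invf_le1 ?ltr0n // ler1n.
pose E (y : R) n : set R := `]y, (y + d n)[%classic.
have muE y n : mu (E y n) = (d n)%:E.
  rewrite /E lebesgue_measure_itv /= lte_fin ltrDl d0.
  by rewrite -EFinD addrC addKr.
have nE y : nicely_shrinking y (E y).
  split=> [n|]; first exact: measurable_itv.
  (* The ball of radius [d n] about [y] is twice as long as the one-sided interval. *)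
  exists (2, fun n => PosNum (d0 n)); split => //= [|n z|n].
  - exact: cvg_harmonic.
  - rewrite /E /= in_itv /= /ball /= ltr_distlC => /andP[yz ->].
    by rewrite andbT (lt_trans _ yz) // ltrBlDr ltrDl.
  by rewrite (lebesgue_measure_ball _ (ltW _)) // muE -EFinM lee_fin mulr_natl.
have lf := L2_locally_integrable Lf.
apply: ae_imp (lebesgue_differentiation lf) => x px.
have c := nice_lebesgue_differentiation nE lf px.
have c' : (fun n => (d n)^-1 * intR (fun y => f y * ind x (x + d n) y)) @ \oo --> f x.
  rewrite (_ : (fun n => _) = fine \o (fun n =>
      ((mu (E x n))^-1 * \int[mu]_(y in E x n) (f y)%:E)%E)); first exact: fine_cvg c.
  by apply/funext => n; rewrite /= muE integral_ind // inver gt_eqF ?d0.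
apply: (cvgr_to_le (cvg_norm c')); near=> n.
rewrite normrM gtr0_norm ?invr_gt0 // ler_pdivrMl // mulrC.
have xd : x < x + d n by rewrite ltrDl.
have xd1 : x < x + d n <= x + 1 by rewrite xd lerD2l d1.
have := interval_average_le Lf xd C0 (fun n' => fb _ _ n' xd1).
by rewrite [X in _ <= _ * X]addrAC subrr add0r.
Unshelve. all: by end_near. Qed.

End Sobolev.

(** * Essential boundedness of functions with weak derivative in L2 *)

Section WeakDerivatives.
Context {R : realType}.
Local Notation mu := (@lebesgue_measure R).
Implicit Types (f g u phi : R -> R) (a b : R).

Lemma test_derive1 phi : test_fun phi -> test_fun (derive1 phi).
Proof.
move=> [sphi [M hM]]; split; first exact: (smooth_derive1 sphi).
exists M => x Mx; rewrite derive1E.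
rewrite (@near_eq_derive _ _ _ phi (cst 0) x 1); first exact: derive_cst.
have c : `|y| @[y --> x] --> `|x| by apply: cvg_norm; exact: cvg_id.
near=> y; rewrite hM //; near: y.
exact: (cvgr_gt _ c).
Unshelve. all: by end_near. Qed.

Lemma test_bound phi : test_fun phi ->
  exists B M, [/\ 0 <= B, 0 <= M & forall x, `|phi x| <= B * ind (- M) M x].
Proof.
move=> [sphi [M hM]].
pose N := `|M| + 1.
have N0 : 0 < N by rewrite ltr_wpDl.
have cphi : {within `[- N, N], continuous (fun x => `|phi x|)}.
  apply: continuous_subspaceT => x; apply: cvg_norm.
  exact: (smooth_continuous sphi).
have NN : - N <= N by rewrite (@le_trans _ _ 0) ?oppr_le0 ?ltW.
have [c _ cP] := EVT_max NN cphi.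
exists `|phi c|, N; split => //; first exact: ltW.
move=> x; rewrite indE; case: ifP => [/andP[l u]|out].
  by rewrite mulr1; apply: cP; rewrite in_itv /= !ltW.
rewrite mulr0 hM ?normr0 // (le_lt_trans (ler_norm _)) //.
rewrite ltNge; apply/negP => xM.
have : `|x| < N by rewrite (le_lt_trans xM) // ltrDl.
by rewrite ltr_norml out.
Qed.

Lemma integM_test f phi : L2 f -> test_fun phi -> integ (fun x => f x * phi x).
Proof.
move=> Lf tphi; have [B [M [B0 _ hB]]] := test_bound tphi.
apply: (norm_le_ind_integ Lf _ B0 hB).
by case: tphi => /smooth_measurable.
Qed.

Lemma weak_deriv_axpy u u1 h h1 (t : R) : L2 u -> L2 u1 -> L2 h -> L2 h1 ->
  weak_deriv u u1 -> weak_deriv h h1 ->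
  weak_deriv (fun x => u x + t * h x) (fun x => u1 x + t * h1 x).
Proof.
move=> Lu Lu1 Lh Lh1 du dh phi tphi.
have ax f g (p : R -> R) : L2 f -> L2 g -> test_fun p ->
    intR (fun x => (f x + t * g x) * p x) =
    intR (fun x => f x * p x) + t * intR (fun x => g x * p x).
  move=> Lf Lg tp; rewrite -intRZ; last exact: integM_test.
  rewrite -intRD; [|exact: integM_test|by apply: integZ; exact: integM_test].
  by apply: eq_intR => x; rewrite mulrDl mulrA.
rewrite ax // ?ax //; last exact: test_derive1.
by rewrite du // dh // mulrN opprD.
Qed.

(** On the middle half of the unit interval both distances to the endpoints are at least 1/4, so the
    exponent is at least -8. The bound does not depend on [a], which makes the later constant
    uniform on the line. *)
Lemma chi_lower_bound a : expR (- 8) / 2 <= intR (bump 0 a (a + 1)).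
Proof.
have e4 : expR (- 8) * intR (ind (a + 4^-1) (a + 3 / 4)) = expR (- 8) / 2.
  by rewrite intR_ind; [congr (_ * _)|]; lra.
rewrite -e4 -intRZ; last exact: integ_ind.
apply: intR_le; [by apply: integZ; exact: integ_ind|exact: integ_bump|].
move=> x; rewrite indE; case: ifP => [/andP[l u]|_]; last by rewrite mulr0 bump_ge0.
rewrite bump_in; last by apply/andP; split; lra.
rewrite mulr1 ler_expR lerN2 invr1 mul1r.
have h (y : R) : 4^-1 <= y -> y^-1 <= 4.
  by move=> hy; rewrite -[4]invrK lef_pV2 // posrE; lra.
have := h (x - a) _; have := h (a + 1 - x) _ => h1 h2.
have : (x - a)^-1 <= 4 by apply: h2; lra.
have : (a + 1 - x)^-1 <= 4 by apply: h1; lra.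
lra.
Qed.

(** The primitive from minus infinity vanishes left of the support of [g], and the zero mean makes
    it vanish on the right too, so it is a test function. *)
Lemma mean_zero_primitive g a b (B : R) : smooth g -> a <= b -> 0 <= B ->
  (forall x, `|g x| <= B * ind a b x) -> intR g = 0 ->
  exists psi, [/\ test_fun psi, derive1 psi = g &
    forall x, `|psi x| <= intR (fun x => `|g x|) * ind (a - 1) (b + 1) x].
Proof.
move=> sg ab B0 gB g0.
have mg := smooth_measurable sg.
have Ig : integ g.
  by apply: (@integ_le R _ _ mg gB); apply: integZ; exact: integ_ind.
have gout x : ~~ (a < x < b) -> g x = 0.
  move=> /negbTE hx; apply/eqP; rewrite -normr_le0 (le_trans (gB x)) //.
  by rewrite indE hx mulr0.
pose psi (x : R) := (\int[mu]_(t in [set` `]-oo, x]]) g t)%R.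
have Igx (x : R) : mu.-integrable `]-oo, x] (EFin \o g).
  by apply: integrableS Ig => //; exact: measurable_itv.
have dpsi x : derivable psi x 1 /\ derive1 psi x = g x.
  apply: (@continuous_FTC1 R g -oo%O x (x + 1)) => //; first by rewrite ltrDl.
    by rewrite ltNyr.
  exact: (@smooth_continuous R g sg x).
have psiE x : psi x = intR (g \_ `]-oo, x]) by rewrite /psi Rintegral_mkcond.
have Ir x : integ (g \_ `]-oo, x]).
  apply: (@integ_le R _ (fun x => `|g x|)); last exact: integ_norm.
    by apply: (measurable_restrictT _ _).1 => //; exact: measurable_funS mg.
  by move=> y; rewrite patchE; case: ifP; rewrite ?normr0.
have psi_out x : ~~ (a - 1 < x < b + 1) -> psi x = 0.
  rewrite negb_and -!leNgt psiE => /orP[xa|bx].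
    rewrite -[RHS]intR0; apply: eq_intR => y; rewrite patchE; case: ifP => //.
    rewrite inE /= in_itv /= => yx; apply: gout.
    by rewrite negb_and -leNgt (le_trans yx) //; lra.
  rewrite -[RHS]g0; apply: eq_intR => y; rewrite patchE; case: ifP => //.
  move=> /negbT; rewrite notin_setE /= in_itv /= => /negP; rewrite -ltNge => xy.
  by rewrite gout // negb_and -!leNgt; apply/orP; right; lra.
exists psi; split.
- split.
    exact: (@smooth_primitive R psi g (fun x => (dpsi x).1)
      (funext (fun x => (dpsi x).2)) sg).
  exists (`|a| + `|b| + 1) => x hx; apply: psi_out; apply/negP => /andP[l u].
  move: hx; rewrite ltNge => /negP; apply.
  have := ler_norm (- a); have := ler_norm b; rewrite normrN => hb ha.
  have := normr_ge0 a; have := normr_ge0 b => b0 a0.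
  by rewrite ler_norml; apply/andP; split; lra.
- by apply/funext => x; have [] := dpsi x.
move=> x; rewrite indE; case: ifP => [_|out]; last first.
  by rewrite psi_out ?out // normr0 mulr0.
rewrite mulr1 psiE; apply: intR_norm_le => //; first exact: integ_norm.
by move=> y; rewrite patchE; case: ifP; rewrite ?normr0.
Qed.

(* Testing against a primitive of [phi - l chi], where [l] makes the mean vanish. *)
Lemma weak_deriv_compare u u1 phi chi a (m : R) : L2 u -> L2 u1 -> weak_deriv u u1 ->
  test_fun phi -> test_fun chi ->
  (forall x, 0 <= phi x <= ind a (a + 1) x) -> (forall x, 0 <= chi x <= ind a (a + 1) x) ->
  0 < m -> m <= intR chi ->
  `|intR (fun x => u x * phi x)| <=
    ((intR (fun x => u x ^+ 2) + 1) / m + 2 * (intR (fun x => u1 x ^+ 2) + 3)) * intR phi.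
Proof.
move=> Lu Lu1 du tphi tchi phi_ind chi_ind m0 chim.
set U := intR _ + 1; set U1 := intR _ + 3.
have sq0 f : 0 <= intR (fun x => f x ^+ 2).
  by apply: Rintegral_ge0 => x _; exact: sqr_ge0.
have U0 : 0 <= U by rewrite addr_ge0.
have U10 : 0 <= U1 by rewrite addr_ge0.
have aa : a <= a + 1 by rewrite lerDl.
have aa1 : a - 1 <= a + 1 + 1.
  by rewrite -[a + 1 + 1]addrA lerD2l; apply: (@le_trans _ _ 0); rewrite ?oppr_le0 ?addr_ge0.
have [sphi _] := tphi; have [schi _] := tchi.
have Itest f : smooth f -> (forall x, 0 <= f x <= ind a (a + 1) x) -> integ f.
  move=> sf hf; apply: (@integ_le R _ (ind a (a + 1))); last exact: integ_ind.
    exact: (smooth_measurable sf).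
  by move=> x; have /andP[f0 f1] := hf x; rewrite ger0_norm.
have Iphi := Itest _ sphi phi_ind; have Ichi := Itest _ schi chi_ind.
have phi0 : 0 <= intR phi by apply: Rintegral_ge0 => x _; case/andP: (phi_ind x).
have chi0 : 0 < intR chi by rewrite (lt_le_trans m0).
have [l lE] : exists l, l = intR phi / intR chi by exists (intR phi / intR chi).
have l0 : 0 <= l by rewrite lE divr_ge0 // ltW.
have lc : l * intR chi = intR phi by rewrite lE divfK ?gt_eqF.
pose g x := phi x - l * chi x.
have sg : smooth g.
  have -> : g = phi + (cst (- l) * chi) by apply/funext => x; rewrite /g /= -mulNr.
  by apply: smoothD => //; apply: smoothM => //; exact: smooth_cst.
have gn x : `|g x| <= phi x + l * chi x.
  have /andP[p0 _] := phi_ind x; have /andP[c0 _] := chi_ind x.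
  by rewrite (le_trans (ler_normB _ _)) // normrM (ger0_norm l0) !ger0_norm.
have gB x : `|g x| <= (1 + l) * ind a (a + 1) x.
  have /andP[p0 p1] := phi_ind x; have /andP[c0 c1] := chi_ind x.
  by rewrite (le_trans (gn x)) // mulrDl mul1r lerD // ler_wpM2l.
have g0 : intR g = 0.
  by rewrite intRB // ?intRZ // ?lc ?subrr //; exact: integZ.
have l1 : 0 <= 1 + l by rewrite addr_ge0.
have [psi [tpsi dpsi psiB]] := mean_zero_primitive sg aa l1 gB g0.
have Igg : integ g by apply: integB => //; exact: integZ.
(* [phi] and [l chi] have the same integral. Thus [l] and the size of [psi] are both controlled by
   the integral of [phi], and the final bound survives division by it as the support shrinks. *)
have gnorm : intR (fun x => `|g x|) <= 2 * intR phi.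
  have -> : 2 * intR phi = intR (fun x => phi x + l * chi x).
    by rewrite intRD ?intRZ // ?lc ?mulr2n ?mulrDl ?mul1r //; exact: integZ.
  by apply: intR_le => //; [exact: integ_norm|apply: integD => //; exact: integZ].
have gn0 : 0 <= intR (fun x => `|g x|) by apply: Rintegral_ge0.
have E : intR (fun x => u x * phi x) = l * intR (fun x => u x * chi x) -
    intR (fun x => u1 x * psi x).
  have Iup : integ (fun x => u x * phi x) by exact: integM_test.
  have Iuc : integ (fun x => u x * chi x) by exact: integM_test.
  have Iug : integ (fun x => u x * g x).
    have := integB Iup (integZ l Iuc); apply: eq_integ => x; rewrite /g; ring.
  have := du psi tpsi; rewrite dpsi => <-.
  rewrite -intRZ // -intRD //; last exact: integZ.
  by apply: eq_intR => x; rewrite /g; ring.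
rewrite E (le_trans (ler_normB _ _)) // normrM (ger0_norm l0).
have A : `|intR (fun x => u x * chi x)| <= U.
  have := @intR_mul_le R u chi a (a + 1) 1 Lu (integ_measurable Ichi) ler01 aa _.
  rewrite mul1r [a + 1 - a]addrAC subrr add0r; apply => x.
  by have /andP[c0 c1] := chi_ind x; rewrite mul1r ger0_norm.
have mpsi : measurable_fun setT psi by case: tpsi => /smooth_measurable.
(* [psi] lives on []a - 1, a + 2[], whose length is the 3 in [U1]. *)
have Bd : `|intR (fun x => u1 x * psi x)| <= intR (fun x => `|g x|) * U1.
  have := @intR_mul_le R u1 psi _ _ _ Lu1 mpsi gn0 aa1 psiB.
  by have -> : a + 1 + 1 - (a - 1) = 3 by ring.
rewrite [(_ + _) * _]mulrDl lerD //.
  rewrite (le_trans (ler_wpM2l l0 A)) // [l * U]mulrC -mulrA ler_wpM2l // mulrC.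
  by rewrite ler_pdivlMr // -lc ler_wpM2l.
by rewrite (le_trans Bd) // mulrAC ler_wpM2r.
Qed.

Lemma weak_deriv_test_bound u u1 : L2 u -> L2 u1 -> weak_deriv u u1 ->
  exists C, 0 <= C /\ forall a b n, a < b <= a + 1 ->
    `|intR (fun x => u x * bump n a b x)| <= C * intR (bump n a b).
Proof.
move=> Lu Lu1 du.
pose m : R := expR (- 8) / 2.
have m0 : 0 < m by rewrite divr_gt0 ?expR_gt0.
exists ((intR (fun x => u x ^+ 2) + 1) / m + 2 * (intR (fun x => u1 x ^+ 2) + 3)); split.
  have sq0 f : 0 <= intR (fun x => f x ^+ 2).
    by apply: Rintegral_ge0 => x _; exact: sqr_ge0.
  by rewrite addr_ge0 ?divr_ge0 ?mulr_ge0 ?addr_ge0 // ltW.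
move=> a b n /andP[ab ba].
apply: (weak_deriv_compare Lu Lu1 du (@test_bump R n a b) (@test_bump R 0 a (a + 1))
  _ _ m0 (chi_lower_bound a)) => x; rewrite bump_ge0 /=; last exact: bump_le_ind.
rewrite (le_trans (bump_le_ind n a b x)) // !indE.
case: ifP => [/andP[ax xb]|_]; first by rewrite ax (lt_le_trans xb).
by case: ifP.
Qed.

Lemma weak_deriv_bounded u u1 : L2 u -> L2 u1 -> weak_deriv u u1 ->
  exists C, 0 <= C /\ \forall x \ae mu, `|u x| <= C.
Proof.
move=> Lu Lu1 du; have [C [C0 hC]] := weak_deriv_test_bound Lu Lu1 du.
by exists C; split => //; exact: ae_norm_le.
Qed.

(** Every bump integrates [u1] to 0, so [ae_norm_le] applies with [C = 0]. *)
Lemma weak_deriv_zero u u1 : L2 u -> L2 u1 -> weak_deriv u u1 ->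
  (\forall x \ae mu, u x = 0) -> \forall x \ae mu, u1 x = 0.
Proof.
move=> Lu Lu1 du u0.
suff : \forall x \ae mu, `|u1 x| <= 0.
  by apply: ae_imp => x; rewrite normr_le0 => /eqP.
apply: ae_norm_le => // a b n _; rewrite mul0r normr_le0.
have tb := @test_bump R n a b.
have := du _ tb; rewrite (_ : intR _ = 0) => [/esym/eqP|].
  by rewrite oppr_eq0.
have mu0 : measurable_fun setT u by case: Lu.
have md : measurable_fun setT (derive1 (bump n a b)).
  by have [s _] := test_derive1 tb; exact: smooth_measurable.
rewrite -[RHS]intR0; apply: ae_eq_intR => //; first exact: measurable_funM.
by apply: ae_imp u0 => x ->; rewrite mul0r.
Qed.

End WeakDerivatives.

(** * Integral comparison under almost everywhere inequalities *)

Section AlmostEverywhereBounds.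
Context {R : realType}.
Local Notation mu := (@lebesgue_measure R).
Implicit Types (f g : R -> R).

(** Truncating [f] between [- |g|] and [|g|] changes it only on a null set and makes the bound hold
    everywhere. *)
Lemma integ_le_ae f g : measurable_fun setT f -> (\forall x \ae mu, `|f x| <= g x) ->
  integ g -> integ f.
Proof.
move=> mf fg Ig; have mg := integ_measurable Ig.
have mng : measurable_fun setT (fun x => `|g x|) by exact: measurableT_comp.
pose k x := Num.max (- `|g x|) (Num.min (f x) `|g x|).
have mk : measurable_fun setT k.
  apply: measurable_maxr; first exact: measurableT_comp.
  exact: measurable_minr.
apply: (@ae_eq_integ R k f) => //.
  apply: ae_imp fg => x fgx; rewrite /k.
  have := le_trans fgx (ler_norm (g x)); rewrite ler_norml => /andP[l u].
  by rewrite (min_idPl u) (max_idPr l).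
apply: (@integ_le R k (fun x => `|g x|)) => //; last exact: integ_norm.
move=> x; rewrite /k ler_norml le_max lexx /= ge_max ge_min lexx orbT andbT.
by rewrite (@le_trans _ _ 0) // oppr_le0.
Qed.

Lemma intR_le_ae f g : integ f -> integ g -> (\forall x \ae mu, f x <= g x) ->
  intR f <= intR g.
Proof.
move=> If Ig fg; have mf := integ_measurable If; have mg := integ_measurable Ig.
have mm : measurable_fun setT (fun x => Num.min (f x) (g x)) by exact: measurable_minr.
have e : \forall x \ae mu, f x = Num.min (f x) (g x).
  by apply: ae_imp fg => x; move/min_idPl => ->.
rewrite (ae_eq_intR mf mm e); apply: intR_le => //.
  exact: (ae_eq_integ mf mm e).
by move=> x; rewrite ge_min lexx orbT.
Qed.

Lemma intR_norm_le_ae f g : integ f -> integ g -> (\forall x \ae mu, `|f x| <= g x) ->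
  `|intR f| <= intR g.
Proof.
move=> If Ig fg; rewrite ler_norml; apply/andP; split.
  rewrite -mulN1r -intRZ //; apply: intR_le_ae => //; first exact: integZ.
  by apply: ae_imp fg => x; rewrite ler_norml mulN1r => /andP[].
by apply: intR_le_ae => //; apply: ae_imp fg => x; rewrite ler_norml => /andP[].
Qed.

End AlmostEverywhereBounds.

(** * Expansion and differentiability of [I], [K], [N] and [J] on [X] *)

Section Functionals.
Context {R : realType}.
Variables (a c a2 c2 b b2 om : R) (F : 'rV[R]_4 -> R).
Hypotheses (cF : C2 F) (F0 : F 0 = 0) (ca : cond_a F) (cb : cond_b F).
Local Notation mu := (@lebesgue_measure R).
Local Notation I := (Iom a c a2 c2 b b2 om).
Local Notation J := (Jom a c a2 c2 b b2 om F).
Local Notation P := (Pom a c a2 c2 b b2 om F).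
Implicit Types (z h : Xrep R).

Lemma Xaxpy0 z h : Xaxpy z 0 h = z.
Proof.
case: z => z0 z1 z2 z3 z4 z5; rewrite /Xaxpy /=.
by congr mkX; apply/funext => x; rewrite mul0r addr0.
Qed.

Lemma XaxpyDl z k h (s r t : R) :
  Xaxpy (Xaxpy (Xaxpy z s k) t h) r k = Xaxpy (Xaxpy z (s + r) k) t h.
Proof. by congr mkX; apply/funext => x /=; ring. Qed.

Lemma inX_axpy z h (t : R) : inX z -> inX h -> inX (Xaxpy z t h).
Proof.
have H2_axpy (u u1 u2 k k1 k2 : R -> R) : H2 u u1 u2 -> H2 k k1 k2 ->
    H2 (fun x => u x + t * k x) (fun x => u1 x + t * k1 x) (fun x => u2 x + t * k2 x).
  move=> [Lu [Lu1 [Lu2 [d1 d2]]]] [Lk [Lk1 [Lk2 [e1 e2]]]].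
  split; first exact: L2_axpy.
  split; first exact: L2_axpy.
  split; first exact: L2_axpy.
  by split; apply: weak_deriv_axpy.
by move=> [A B] [A' B']; split; exact: H2_axpy.
Qed.

Definition jet z (x : R) : 'rV[R]_4 := vec4 (ps z x) (ps1 z x) (vv z x) (vv1 z x).

Lemma jet_axpy z h (t : R) x : jet (Xaxpy z t h) x = jet z x + t *: jet h x.
Proof.
apply/rowP => i; rewrite !mxE /=.
by case: i => [[|[|[|[|i]]]] hi].
Qed.

(** First derivatives are bounded because the second ones are their weak derivatives in L2. Second
    derivatives need not be bounded; they enter only the quadratic form. *)
Lemma jet_bounded z : inX z ->
  exists M, 0 <= M /\ \forall x \ae mu, entries_le M (jet z x).
Proof.
move=> [[Lu [Lu1 [Lu2 [d1 d2]]]] [Lv [Lv1 [Lv2 [e1 e2]]]]].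
have [A [A0 hA]] := weak_deriv_bounded Lu Lu1 d1.
have [B [B0 hB]] := weak_deriv_bounded Lu1 Lu2 d2.
have [C [C0 hC]] := weak_deriv_bounded Lv Lv1 e1.
have [D [D0 hD]] := weak_deriv_bounded Lv1 Lv2 e2.
exists (A + B + C + D); split; first by rewrite !addr_ge0.
apply: ae_imp (ae_and (ae_and hA hB) (ae_and hC hD)) => x [[xA xB] [xC xD]] i.
by rewrite mxE; case: i => [[|[|[|[|i]]]] hi] //=; lra.
Qed.

Lemma sq_jet z x : sq (jet z x) = ps z x ^+ 2 + ps1 z x ^+ 2 + vv z x ^+ 2 + vv1 z x ^+ 2.
Proof. by rewrite /sq !big_ord_recl big_ord0 !mxE /= addr0 !addrA. Qed.

Lemma integ_sq_jet z : inX z -> integ (fun x => sq (jet z x)).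
Proof.
move=> [[Lu [Lu1 [Lu2 _]]] [Lv [Lv1 [Lv2 _]]]].
have := integD (integD (integD (L2_integ Lu) (L2_integ Lu1)) (L2_integ Lv)) (L2_integ Lv1).
by apply: eq_integ => x; rewrite sq_jet.
Qed.

Lemma measurable_jet (H : 'rV[R]_4 -> R) z : continuous H -> inX z ->
  measurable_fun setT (fun x => H (jet z x)).
Proof.
move=> cH [[[m0 _] [[m1 _] _]] [[m2 _] [[m3 _] _]]].
exact: measurable_vec4.
Qed.

Lemma measurable_jet_coord z i : inX z -> measurable_fun setT (fun x => jet z x 0 i).
Proof.
move=> iz; apply: (@measurable_jet (fun w : 'rV[R]_4 => w 0 i)) => //.
exact: (@coord_continuous R _ _ 0 i).
Qed.

(** Density of [K'(z)h]; for [h = z] it is the integrand of [N]. *)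
Definition grad_dot z h (x : R) : R := \sum_(i < 4) jet h x 0 i * pd F i (jet z x).

Lemma measurable_grad_dot z h : inX z -> inX h -> measurable_fun setT (grad_dot z h).
Proof.
move=> iz ih; have [_ [_ [cpd _]]] := cF.
rewrite /grad_dot; under eq_fun do rewrite !big_ord_recl big_ord0 addr0.
have m i : measurable_fun setT (fun x => jet h x 0 i * pd F i (jet z x)).
  by apply: measurable_funM; [exact: measurable_jet_coord|exact: measurable_jet].
by do 3!(apply: measurable_funD; first exact: m); exact: m.
Qed.

Lemma integ_F z : inX z -> integ (fun x => F (jet z x)).
Proof.
move=> iz; have [M [M0 hM]] := jet_bounded iz.
have [C [C0 hC]] := F_quadratic cF ca cb F0 M0.
apply: (@integ_le_ae R _ (fun x => C * sq (jet z x))).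
- by apply: measurable_jet => //; exact/C1_continuous/C2_C1.
- by apply: ae_imp hM => x; exact: hC.
by apply: integZ; exact: integ_sq_jet.
Qed.

Lemma integ_grad_dot z h : inX z -> inX h -> integ (grad_dot z h).
Proof.
move=> iz ih; have [M [M0 hM]] := jet_bounded iz.
have [C [C0 hC]] := grad_dot_bound cF ca cb M0.
apply: (@integ_le_ae R _ (fun x => C * (sq (jet z x) + sq (jet h x)))).
- exact: measurable_grad_dot.
- by apply: ae_imp hM => x; exact: hC.
by apply: integZ; apply: integD; exact: integ_sq_jet.
Qed.

Lemma integ_G z : inX z -> integ (fun x => Gf F (jet z x)).
Proof. by move=> iz; have := integ_grad_dot iz iz. Qed.

Lemma N_lipschitz z h : inX z -> inX h -> exists C, 0 <= C /\
  forall r : R, `|r| <= 1 -> `|Nf F (Xaxpy z r h) - Nf F z| <= C * `|r|.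
Proof.
move=> iz ih; have [M1 [M10 h1]] := jet_bounded iz; have [M2 [M20 h2]] := jet_bounded ih.
have M0 : 0 <= M1 + M2 by rewrite addr_ge0.
have [C [C0 hC]] := G_lipschitz cF ca cb M0.
have Isq := integD (integ_sq_jet iz) (integ_sq_jet ih).
exists (C * intR (fun x => sq (jet z x) + sq (jet h x))); split.
  by rewrite mulr_ge0 //; apply: Rintegral_ge0 => x _; rewrite addr_ge0 ?sq_ge0.
move=> r r1; rewrite /Nf -intRB; [|exact: (integ_G (inX_axpy r iz ih))|exact: integ_G].
rewrite mulrAC -intRZ //; apply: intR_norm_le_ae.
- by apply: integB; [exact: (integ_G (inX_axpy r iz ih))|exact: integ_G].
- exact: integZ.
apply: ae_imp (ae_and h1 h2) => x [bz bh].
rewrite -[vec4 (ps (Xaxpy _ _ _) _) _ _ _]/(jet (Xaxpy z r h) x) jet_axpy.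
apply: hC => //; [apply: entries_leW bz|apply: entries_leW bh]; by rewrite ?lerDl ?lerDr.
Qed.

(** Polarization of the integrand of [I]; symmetrizing turns each mixed product of [2 om I2] into
    two terms with factor [om]. *)
Definition bilp z h (x : R) : R :=
  ps z x * ps h x + (- c) * (ps1 z x * ps1 h x) + c2 * (ps2 z x * ps2 h x)
  + vv z x * vv h x + (- a) * (vv1 z x * vv1 h x) + a2 * (vv2 z x * vv2 h x)
  + (- om) * (ps z x * vv h x) + (- om) * (vv z x * ps h x)
  + (- om * b) * (ps1 z x * vv1 h x) + (- om * b) * (vv1 z x * ps1 h x)
  + (- om * b2) * (ps2 z x * vv2 h x) + (- om * b2) * (vv2 z x * ps2 h x).

Definition bil z h : R := intR (bilp z h).

Lemma integ_bilp z h : inX z -> inX h -> integ (bilp z h).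
Proof.
move=> [[Lu [Lu1 [Lu2 _]]] [Lv [Lv1 [Lv2 _]]]] [[Ku [Ku1 [Ku2 _]]] [Kv [Kv1 [Kv2 _]]]].
rewrite /bilp.
do 11!(apply: integD; last first; [first [by apply: integM|by apply: integZ; apply: integM]|]).
exact: integM.
Qed.

Lemma Iom_bil z : inX z -> I z = bil z z.
Proof.
move=> [[Lu [Lu1 [Lu2 _]]] [Lv [Lv1 [Lv2 _]]]].
rewrite /Iom /I1 /I2 /bil -intRZ; last first.
  have := integD (integD (integM Lu Lv) (integZ b (integM Lu1 Lv1))) (integZ b2 (integM Lu2 Lv2)).
  by apply: eq_integ => x; ring.
rewrite -intRB; first by apply: eq_intR => x; rewrite /bilp; ring.
- have := integD (integD (integD (integD (integD (L2_integ Lu) (integZ (- c) (L2_integ Lu1)))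
    (integZ c2 (L2_integ Lu2))) (L2_integ Lv)) (integZ (- a) (L2_integ Lv1)))
    (integZ a2 (L2_integ Lv2)).
  by apply: eq_integ => x; ring.
apply: integZ.
have := integD (integD (integM Lu Lv) (integZ b (integM Lu1 Lv1))) (integZ b2 (integM Lu2 Lv2)).
by apply: eq_integ => x; ring.
Qed.

Lemma Iom_axpy z h (t : R) : inX z -> inX h ->
  I (Xaxpy z t h) = I z + 2 * t * bil z h + t ^+ 2 * I h.
Proof.
move=> iz ih; rewrite !Iom_bil //; last exact: inX_axpy.
have A := integ_bilp iz iz; have B := integ_bilp iz ih; have C := integ_bilp ih ih.
rewrite /bil -intRZ // -intRZ // -!intRD //; try exact: integZ.
  by apply: eq_intR => x; rewrite /bilp /=; ring.
by apply: integD => //; exact: integZ.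
Qed.

Definition Jderiv z h : R := bil z h - intR (grad_dot z h).

(** The expansion is made at [s z] but with the derivative taken at [z]. The constant is uniform in
    [s], as it must be, since [s] is produced later by the intermediate value theorem. *)
Lemma K_taylor z h : inX z -> inX h -> exists C, 0 <= C /\
  forall s t : R, 0 <= s <= 2 -> `|t| <= 1 ->
   `|Kf F (Xaxpy (Xaxpy z (s - 1) z) t h) - Kf F (Xaxpy z (s - 1) z) - t * intR (grad_dot z h)|
     <= C * (t ^+ 2 + `|t| * `|s - 1|).
Proof.
move=> iz ih; have [M1 [M10 h1]] := jet_bounded iz; have [M2 [M20 h2]] := jet_bounded ih.
(* The factor 2 bounds [s], so the box contains the jets of both [s z] and [h]. *)
pose M := 2 * M1 + M2.
have M0 : 0 <= M by rewrite addr_ge0 ?mulr_ge0.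
have [C [C0 hC]] := F_taylor cF cb M0.
have [D [D0 hD]] := grad_scale cF cb M10.
have Iz := integ_sq_jet iz; have Ih := integ_sq_jet ih.
pose Q := intR (fun x => sq (jet z x) + sq (jet h x)).
have Q0 : 0 <= Q by apply: Rintegral_ge0 => x _; rewrite addr_ge0 ?sq_ge0.
exists ((C + D) * Q); split; first by rewrite mulr_ge0 ?addr_ge0.
move=> s t s2 t1.
set zs := Xaxpy z (s - 1) z.
have izs : inX zs by exact: inX_axpy.
have izt : inX (Xaxpy zs t h) by exact: inX_axpy.
have jzs x : jet zs x = s *: jet z x.
  by rewrite jet_axpy -[X in X + _]scale1r -scalerDl addrC subrK.
have IF := integ_F izs; have IFt := integ_F izt; have Ig := integ_grad_dot iz ih.
rewrite /Kf -/(jet _ _) -(intRB IFt IF) -intRZ // -intRB; [|exact: integB|exact: integZ].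
have -> : (C + D) * Q * (t ^+ 2 + `|t| * `|s - 1|) =
    intR (fun x => (C + D) * (t ^+ 2 + `|t| * `|s - 1|) * (sq (jet z x) + sq (jet h x))).
  by rewrite intRZ; [rewrite -/Q mulrAC|exact: integD].
apply: intR_norm_le_ae.
- by apply: integB; [exact: integB|exact: integZ].
- by apply: integZ; exact: integD.
apply: ae_imp (ae_and h1 h2) => x [b1 b2'].
rewrite -/(jet (Xaxpy zs t h) x) -/(jet zs x) jet_axpy jzs.
have bs : entries_le M (s *: jet z x).
  by apply: entries_leW (entries_leZ s2 b1); rewrite lerDl.
have bh : entries_le M (jet h x) by apply: entries_leW b2'; rewrite lerDr mulr_ge0.
have T := hC _ _ _ bs bh t1.
have S := hD (jet z x) (jet h x) s b1 s2.
have sz := sq_ge0 (jet z x); have sh := sq_ge0 (jet h x).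
rewrite /grad_dot.
set A := F (_ + _) - F _ in T *.
set g1 := \sum_(i < 4) _ * pd F i (s *: _) in T S *.
set g0 := \sum_(i < 4) _ * _ in S *.
(* [g1] is the derivative at [s z]: the first bracket is the Taylor error of order [t^2], the second
   the cost of moving the gradient back to [z]. *)
have -> : A - t * g0 = (A - t * g1) + t * (g1 - g0) by ring.
rewrite (le_trans (ler_normD _ _)) // normrM.
have S' : `|t| * `|g1 - g0| <= `|t| * (D * `|s - 1| * (sq (jet z x) + sq (jet h x))).
  by rewrite ler_wpM2l.
rewrite (le_trans (lerD T S')) //.
set q := sq (jet z x) in sz *; set k := sq (jet h x) in sh *.
have t20 : 0 <= t ^+ 2 by exact: sqr_ge0.
have ts0 : 0 <= `|t| * `|s - 1| by rewrite mulr_ge0.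
rewrite -subr_ge0.
have -> : (C + D) * (t ^+ 2 + `|t| * `|s - 1|) * (q + k) -
    (C * t ^+ 2 * k + `|t| * (D * `|s - 1| * (q + k))) =
    C * t ^+ 2 * q + C * (`|t| * `|s - 1|) * (q + k) + D * t ^+ 2 * (q + k) by ring.
have qk : 0 <= q + k by exact: addr_ge0.
by apply: addr_ge0; [apply: addr_ge0|]; apply: mulr_ge0 => //; exact: mulr_ge0.
Qed.

Lemma J_taylor z h : inX z -> inX h -> exists C, 0 <= C /\
  forall s t : R, 0 <= s <= 2 -> `|t| <= 1 ->
   `|J (Xaxpy (Xaxpy z (s - 1) z) t h) - J (Xaxpy z (s - 1) z) - t * Jderiv z h|
     <= C * (t ^+ 2 + `|t| * `|s - 1|).
Proof.
move=> iz ih; have [C [C0 hC]] := K_taylor iz ih.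
exists (C + `|I h / 2| + `|bil z h|); split; first by rewrite !addr_ge0.
move=> s t s2 t1; have := hC s t s2 t1.
set zs := Xaxpy z (s - 1) z.
have izs : inX zs by exact: inX_axpy.
have Bs : bil zs h = s * bil z h.
  rewrite /bil -intRZ; last exact: integ_bilp.
  by apply: eq_intR => x; rewrite /bilp /=; ring.
rewrite /Jom /Jderiv Iom_axpy // Bs.
set Kt := Kf F _; set K0 := Kf F _; set g := intR _ => H.
have -> : (I zs + 2 * t * (s * bil z h) + t ^+ 2 * I h) / 2 - Kt - (I zs / 2 - K0) -
   t * (bil z h - g) = t ^+ 2 * (I h / 2) + (t * (s - 1)) * bil z h - (Kt - K0 - t * g).
  by field.
rewrite (le_trans (ler_normB _ _)) // (le_trans (lerD (ler_normD _ _) H)) //.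
rewrite [`|t ^+ 2 * _|]normrM [`|t * (s - 1) * _|]normrM [`|t * (s - 1)|]normrM.
rewrite [`|t ^+ 2|]ger0_norm ?sqr_ge0 //.
have t20 : 0 <= t ^+ 2 by exact: sqr_ge0.
have ts0 : 0 <= `|t| * `|s - 1| by rewrite mulr_ge0.
have i0 := normr_ge0 (I h / 2); have b0 := normr_ge0 (bil z h).
rewrite -subr_ge0.
have -> : (C + `|I h / 2| + `|bil z h|) * (t ^+ 2 + `|t| * `|s - 1|) -
   (t ^+ 2 * `|I h / 2| + `|t| * `|s - 1| * `|bil z h| + C * (t ^+ 2 + `|t| * `|s - 1|)) =
   (`|t| * `|s - 1|) * `|I h / 2| + t ^+ 2 * `|bil z h| by ring.
by rewrite addr_ge0 // mulr_ge0.
Qed.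

Lemma J_is_derive z h : inX z -> inX h ->
  is_derive (0 : R) (1 : R) (fun t : R => J (Xaxpy z t h)) (Jderiv z h).
Proof.
move=> iz ih; have [C [C0 hC]] := J_taylor iz ih.
have E : (fun t : R => t^-1 *: (J (Xaxpy z (t *: 1 + 0) h) - J (Xaxpy z 0 h))) @ 0^'
    --> Jderiv z h.
  apply: (@cvg_norm_bound _ _ _ _ C) => t t0 t1.
  have := hC 1 t; rewrite subrr normr0 mulr0 addr0 !Xaxpy0 ler01 ler1n => /(_ isT t1) H.
  rewrite addr0 /GRing.scale /= mulr1.
  have -> : t^-1 * (J (Xaxpy z t h) - J z) - Jderiv z h =
      t^-1 * (J (Xaxpy z t h) - J z - t * Jderiv z h) by field.
  rewrite normrM normfV ler_pdivrMl ?normr_gt0 // mulrCA -expr2.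
  by rewrite (real_normK (num_real t)).
split; first by apply/cvg_ex; exists (Jderiv z h).
exact/cvg_lim.
Qed.

End Functionals.

(** * Elementary real inequalities and the choice of small parameters *)

Section RealEstimates.
Context {R : realType}.
Implicit Types (f : R -> R) (e m t : R).

(** Lowering both coefficients to [|m|] leaves [|m|] times a perfect square, [(x - y)^2] or
    [(x + y)^2] according to the sign of [m]. *)
Lemma quad_ge0 (k l m x y : R) : `|m| <= k -> `|m| <= l ->
  0 <= k * x ^+ 2 + l * y ^+ 2 - 2 * m * (x * y).
Proof.
move=> mk ml.
have A : `|m| * x ^+ 2 <= k * x ^+ 2 by rewrite ler_wpM2r ?sqr_ge0.
have A' : `|m| * y ^+ 2 <= l * y ^+ 2 by rewrite ler_wpM2r ?sqr_ge0.
suff : 0 <= `|m| * x ^+ 2 + `|m| * y ^+ 2 - 2 * m * (x * y) by lra.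
have [m0|m0] := leP 0 m.
  rewrite (ger0_norm m0).
  have -> : m * x ^+ 2 + m * y ^+ 2 - 2 * m * (x * y) = m * (x - y) ^+ 2 by ring.
  by rewrite mulr_ge0 ?sqr_ge0.
rewrite (ltr0_norm m0).
have -> : - m * x ^+ 2 + - m * y ^+ 2 - 2 * m * (x * y) = - m * (x + y) ^+ 2 by ring.
by rewrite mulr_ge0 ?sqr_ge0 // oppr_ge0 ltW.
Qed.

Lemma locally_lipschitz_continuous (f : R -> R) :
  (forall x, exists C, 0 <= C /\
    forall r : R, `|r| <= 1 -> `|f (x + r) - f x| <= C * `|r|) ->
  continuous f.
Proof.
move=> lf x; have [C [C0 hC]] := lf x.
apply/cvgrPdist_le => e e0; near=> y.
have y1 : `|y - x| <= 1.
  by rewrite distrC; near: y; exact: cvgr_dist_le.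
have y2 : `|y - x| <= e / (C + 1).
  rewrite distrC; near: y; apply: cvgr_dist_le => //.
  by rewrite divr_gt0 // ltr_wpDl.
have := hC _ y1; rewrite [x + _]addrC subrK distrC => /le_trans; apply.
rewrite (le_trans (ler_wpM2l C0 y2)) // mulrCA ler_piMr ?(ltW e0) //.
by rewrite ler_pdivrMr ?mul1r ?lerDl // ltr_wpDl.
Unshelve. all: by end_near. Qed.

Lemma IVT_decreasing f e : 0 < e -> continuous f -> 0 <= f (1 - e) -> f (1 + e) <= 0 ->
  exists s, 1 - e <= s <= 1 + e /\ f s = 0.
Proof.
move=> e0 cf fm fp.
have le1 : 1 - e <= 1 + e by lra.
have [||s] := @IVT R f (1 - e) (1 + e) 0 le1.
- exact: continuous_subspaceT.
- by rewrite ge_min le_max fp fm orbT.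
by rewrite in_itv /= => sb E; exists s.
Qed.

Lemma dist_lt_opp (x y e : R) : `|x - y| <= e -> e < - y -> x <= 0.
Proof. by rewrite ler_norml => /andP[? ?] ?; lra. Qed.

Lemma dist_lt_pos (x y e : R) : `|x - y| <= e -> e < y -> 0 <= x.
Proof. by rewrite ler_norml => /andP[? ?] ?; lra. Qed.

Lemma one_sub_itv e : 0 < e <= 2^-1 -> 0 < 1 - e < 1.
Proof. by move=> /andP[? ?]; apply/andP; split; lra. Qed.

Lemma near_one_bounds e (s : R) : 0 < e <= 2^-1 -> 1 - e <= s <= 1 + e ->
  [/\ 2^-1 <= s, 0 <= s <= 2 & `|s - 1| <= e].
Proof.
move=> /andP[? ?] /andP[? ?]; split; first lra.
  by apply/andP; split; lra.
by rewrite ler_norml; apply/andP; split; lra.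
Qed.

Lemma eighth_le (s q : R) : 2^-1 <= s -> 0 <= q -> q / 8 <= s ^+ 2 / 2 * q.
Proof.
move=> hs q0; have h4 : 4^-1 <= s ^+ 2.
  by have := sqr_ge0 (s - 2^-1); rewrite !expr2; lra.
by have := ler_wpM2r q0 h4; lra.
Qed.

Lemma le_combine (jw js jz x e e' : R) : `|jw - js - x| <= e -> e <= e' ->
  jz <= jw -> js <= jz -> 0 <= x + e'.
Proof. by rewrite ler_norml => /andP[? ?] ? ? ?; lra. Qed.

Lemma norm_le_of_pm (A C t d : R) : 0 < t -> 0 <= t * A + C * (t * d) ->
  0 <= - t * A + C * (t * d) -> `|A| <= C * d.
Proof.
by move=> t0 kp km; rewrite ler_norml; apply/andP; split; rewrite -(ler_pM2l t0); lra.
Qed.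

Lemma mul_lt_of_le_div (K m t : R) : 0 <= K -> 0 < m -> 0 <= t ->
  t <= m / (K + 1) -> K * t < m.
Proof.
move=> K0 m0 t0; rewrite ler_pdivlMr ?ltr_wpDl // => h.
have [->|tn] := eqVneq t 0; first by rewrite mulr0.
have : 0 < t by rewrite lt_def tn.
lra.
Qed.

Lemma exists_small e (m1 m2 m3 K1 K2 K3 : R) : 0 < e -> 0 < m1 -> 0 < m2 -> 0 < m3 ->
  0 <= K1 -> 0 <= K2 -> 0 <= K3 ->
  exists t, [/\ 0 < t, t <= e, K1 * t < m1, K2 * t < m2 & K3 * t < m3].
Proof.
move=> e0 p1 p2 p3 k1 k2 k3.
(* The denominators are [K + 1] because each [K] may be 0. *)
pose x1 := m1 / (K1 + 1); pose x2 := m2 / (K2 + 1); pose x3 := m3 / (K3 + 1).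
have y1 : 0 < x1 by rewrite divr_gt0 // ltr_wpDl.
have y2 : 0 < x2 by rewrite divr_gt0 // ltr_wpDl.
have y3 : 0 < x3 by rewrite divr_gt0 // ltr_wpDl.
pose t := Num.min e (Num.min x1 (Num.min x2 x3)).
have t0 : 0 < t by rewrite !lt_min e0 y1 y2 y3.
exists t; split => //.
- by rewrite ge_min lexx.
- by apply: mul_lt_of_le_div => //; rewrite ?(ltW t0) // !ge_min lexx orbT.
- by apply: mul_lt_of_le_div => //; rewrite ?(ltW t0) // !ge_min lexx !orbT.
- by apply: mul_lt_of_le_div => //; rewrite ?(ltW t0) // !ge_min lexx !orbT.
Qed.

Lemma eq0_of_norm_le (A C : R) : 0 <= C ->
  (forall e, 0 < e <= 2^-1 -> `|A| <= C * (e + e)) -> A = 0.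
Proof.
move=> C0 hC; apply/eqP/negPn/negP => A0; have An : 0 < `|A| by rewrite normr_gt0.
pose e := Num.min 2^-1 (`|A| / 2 / (C + 1)).
have e0 : 0 < e by rewrite lt_min invr_gt0 ltr0n /= !divr_gt0 // ltr_wpDl.
have e2 : e <= 2^-1 by rewrite ge_min lexx.
have e3 : e <= `|A| / 2 / (C + 1) by rewrite ge_min lexx orbT.
have h2 : 0 < `|A| / 2 by rewrite divr_gt0.
have := hC e; rewrite e0 e2 => /(_ isT).
have := mul_lt_of_le_div C0 h2 (ltW e0) e3; lra.
Qed.

End RealEstimates.

(** * Scaling on the Nehari set and vanishing of the derivative *)

Section NehariMinimizer.
Context {R : realType}.
Variables (a c a2 c2 b b2 om : R) (F : 'rV[R]_4 -> R).
Hypotheses (cF : C2 F) (F0 : F 0 = 0) (ca : cond_a F) (cb : cond_b F).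
Hypotheses (om1 : `|om| < 1) (oma : `|om * b| <= - a) (omc : `|om * b| <= - c)
  (oma2 : `|om * b2| <= a2) (omc2 : `|om * b2| <= c2).
Local Notation mu := (@lebesgue_measure R).
Local Notation I := (Iom a c a2 c2 b b2 om).
Local Notation J := (Jom a c a2 c2 b b2 om F).
Local Notation P := (Pom a c a2 c2 b b2 om F).
Local Notation B := (bil a c a2 c2 b b2 om).
Implicit Types (z h : Xrep R).

(** A quantitative form of [nonzeroX], which is stable under small perturbations. *)
Definition Q2 z : R := intR (fun x => ps z x ^+ 2 + vv z x ^+ 2).

Lemma integ_Q2 z : inX z -> integ (fun x => ps z x ^+ 2 + vv z x ^+ 2).
Proof. by move=> [[Lu _] [Lv _]]; apply: integD; exact: L2_integ. Qed.

Lemma Q2_ge0 z : 0 <= Q2 z.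
Proof. by apply: Rintegral_ge0 => x _; rewrite addr_ge0 ?sqr_ge0. Qed.

Lemma Q2_gt0 z : inX z -> nonzeroX z -> 0 < Q2 z.
Proof.
move=> iz nz; rewrite ltNge; apply/negP => le0; apply: nz.
have ge0 x : 0 <= ps z x ^+ 2 + vv z x ^+ 2 by rewrite addr_ge0 ?sqr_ge0.
have e := intR_eq0_ae (integ_Q2 iz) ge0 le0.
split; apply: ae_imp e => x /eqP; rewrite paddr_eq0 ?sqr_ge0 // !sqrf_eq0;
  by case/andP => /eqP + /eqP.
Qed.

Lemma nonzeroX_Q2 z : inX z -> 0 < Q2 z -> nonzeroX z.
Proof.
move=> iz q0 [p0 v0]; move: q0; rewrite /Q2 (_ : intR _ = 0) ?ltxx //.
rewrite -[RHS]intR0; apply: ae_eq_intR => //; first exact: integ_measurable (integ_Q2 iz).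
by apply: ae_imp (ae_and p0 v0) => x [-> ->]; rewrite expr0n addr0.
Qed.

(** The integrand splits into binary forms in the derivatives of order 0, 1 and 2. Those of order 1
    and 2 are nonnegative; the one of order 0 keeps the surplus [1 - |om|]. *)
Lemma Iom_coercive z : inX z -> (1 - `|om|) * Q2 z <= I z.
Proof.
move=> iz; rewrite Iom_bil // /Q2 -intRZ; last exact: integ_Q2.
apply: intR_le; [by apply: integZ; exact: integ_Q2|exact: integ_bilp|move=> x].
have A := quad_ge0 (ps z x) (vv z x) (lexx `|om|) (lexx `|om|).
have A' := quad_ge0 (ps1 z x) (vv1 z x) omc oma.
have A'' := quad_ge0 (ps2 z x) (vv2 z x) omc2 oma2.
rewrite -subr_ge0; have := addr_ge0 (addr_ge0 A A') A''.
by congr (0 <= _); rewrite /bilp; ring.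
Qed.

Lemma Iom_gt0 z : inX z -> nonzeroX z -> 0 < I z.
Proof.
move=> iz nz; apply: lt_le_trans (Iom_coercive iz).
by rewrite mulr_gt0 ?subr_gt0 // Q2_gt0.
Qed.

Definition scaled z (s : R) : Xrep R := Xaxpy z (s - 1) z.

Lemma inX_scaled z s : inX z -> inX (scaled z s).
Proof. by move=> iz; exact: inX_axpy. Qed.

Lemma jet_scaled z s x : jet (scaled z s) x = s *: jet z x.
Proof. by rewrite jet_axpy -[X in X + _]scale1r -scalerDl addrC subrK. Qed.

Lemma Iom_scaled z s : inX z -> I (scaled z s) = s ^+ 2 * I z.
Proof. by move=> iz; rewrite Iom_axpy // -Iom_bil //; ring. Qed.

Lemma Q2_axpy_ge z h (s t : R) : inX z -> inX h ->
  s ^+ 2 / 2 * Q2 z - t ^+ 2 * Q2 h <= Q2 (Xaxpy (scaled z s) t h).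
Proof.
move=> iz ih; rewrite /Q2 -!intRZ; try exact: integ_Q2.
rewrite -intRB; try by apply: integZ; exact: integ_Q2.
apply: intR_le.
- by apply: integB; apply: integZ; exact: integ_Q2.
- by apply: integ_Q2; apply: inX_axpy => //; exact: inX_scaled.
move=> x /=; rewrite -subr_ge0.
(* The gap between the two sides is exactly half of this sum of squares. *)
have := addr_ge0 (sqr_ge0 (s * ps z x + 2 * t * ps h x)) (sqr_ge0 (s * vv z x + 2 * t * vv h x)).
have i2 : (0 : R) <= 2^-1 by rewrite invr_ge0.
by move/(mulr_ge0 i2); congr (0 <= _); field.
Qed.

Lemma expR_ln_sqr (s : R) : 0 < s -> expR (2 * ln s) = s ^+ 2.
Proof. by move=> s0; rewrite expRM_natl lnK. Qed.

Lemma N_scaled_ge z (q s : R) : (forall w, wgrad (Gf F) w >= q * Gf F w) ->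
  inX z -> 1 <= s -> expR (q * ln s) * Nf F z <= Nf F (scaled z s).
Proof.
move=> hq iz s1; have s0 : 0 < s by rewrite (lt_le_trans ltr01).
rewrite /Nf -intRZ; last exact: integ_G.
apply: intR_le; [by apply: integZ; exact: integ_G|exact: integ_G (inX_scaled s iz)|move=> x].
rewrite -/(jet z x) -/(jet (scaled z s) x) jet_scaled -{2}[s]lnK ?posrE //.
by apply: G_exp_ge => //; exact: ln_ge0.
Qed.

Lemma N_scaled_le z (q s : R) : (forall w, wgrad (Gf F) w >= q * Gf F w) ->
  inX z -> 0 < s <= 1 -> Nf F (scaled z s) <= expR (q * ln s) * Nf F z.
Proof.
move=> hq iz /andP[s0 s1].
rewrite /Nf -intRZ; last exact: integ_G.
apply: intR_le; [exact: integ_G (inX_scaled s iz)|by apply: integZ; exact: integ_G|move=> x].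
rewrite -/(jet z x) -/(jet (scaled z s) x) jet_scaled -{1}[s]lnK ?posrE //.
by apply: G_exp_le => //; exact: ln_le0.
Qed.

Lemma P_scaled_lt0 z s : inX z -> 0 < I z -> P z = 0 -> 1 < s -> P (scaled z s) < 0.
Proof.
move=> iz I0 Pz s1; have [p [p0 hp]] := ca.
have NI : Nf F z = I z by move: Pz; rewrite /Pom => /subr0_eq.
have := N_scaled_ge hp iz (ltW s1); rewrite NI => h.
rewrite /Pom Iom_scaled // subr_lt0 (lt_le_trans _ h) // ltr_pM2r //.
have s0 : 0 < s by rewrite (lt_trans ltr01).
by rewrite -expR_ln_sqr // ltr_expR ltr_pM2r ?ln_gt0 // ltrDr.
Qed.

Lemma P_scaled_gt0 z s : inX z -> 0 < I z -> P z = 0 -> 0 < s < 1 -> 0 < P (scaled z s).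
Proof.
move=> iz I0 Pz /andP[s0 s1]; have [p [p0 hp]] := ca.
have NI : Nf F z = I z by move: Pz; rewrite /Pom => /subr0_eq.
have s01 : 0 < s <= 1 by rewrite s0 ltW.
have := N_scaled_le hp iz s01; rewrite NI => h.
rewrite /Pom Iom_scaled // subr_gt0 (le_lt_trans h) // ltr_pM2r //.
by rewrite -expR_ln_sqr // ltr_expR ltr_nM2r ?ln_lt0 ?s0 // ltrDr.
Qed.

(** Integrating [F_exp_ge] gives [K(s z) - K(z) >= k N(z) = k I(z)], and [k >= (s^2 - 1)/2] absorbs
    the change of [I / 2]. The comparison is made pointwise, so nothing is differentiated in [s]
    under the integral. *)
Lemma J_scaled_le z s : inX z -> 0 < I z -> P z = 0 -> 0 < s -> J (scaled z s) <= J z.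
Proof.
move=> iz I0 Pz s0; have [p [p0 hp]] := ca.
have NI : Nf F z = I z by move: Pz; rewrite /Pom => /subr0_eq.
have q0 : 0 < p + 2 by rewrite addr_gt0.
pose k := (expR ((p + 2) * ln s) - 1) / (p + 2).
have Kge : Kf F z + k * Nf F z <= Kf F (scaled z s).
  have IF := integ_F cF F0 ca cb iz; have IG := integ_G cF ca cb iz.
  rewrite /Kf /Nf -intRZ // -intRD //; last exact: integZ.
  apply: intR_le.
  - by apply: integD => //; exact: integZ.
  - exact: integ_F (inX_scaled s iz).
  move=> x; rewrite -/(jet z x) -/(jet (scaled z s) x) jet_scaled -[X in F (X *: _)]lnK ?posrE //.
  by rewrite mulrC; apply: F_exp_ge.
have kge : (s ^+ 2 - 1) / 2 <= k.
  rewrite -expR_ln_sqr //; apply: exp_quotient_ge; lra.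
have := ler_wpM2r (ltW I0) kge.
rewrite NI in Kge; rewrite /Jom Iom_scaled // => H.
have -> : s ^+ 2 * I z / 2 = (s ^+ 2 - 1) / 2 * I z + I z / 2 by field.
lra.
Qed.

Lemma P_lipschitz z h : inX z -> inX h -> exists C, 0 <= C /\
  forall r : R, `|r| <= 1 -> `|P (Xaxpy z r h) - P z| <= C * `|r|.
Proof.
move=> iz ih; have [C [C0 hC]] := N_lipschitz cF ca cb iz ih.
exists (C + 2 * `|B z h| + `|I h|); split; first by rewrite !addr_ge0 ?mulr_ge0.
move=> r r1; have := hC r r1; rewrite /Pom Iom_axpy // => H.
set N1 := Nf F _ in H *; set N0 := Nf F _ in H *.
have -> : I z + 2 * r * B z h + r ^+ 2 * I h - N1 - (I z - N0) =
  r * (2 * B z h) + r * (r * I h) - (N1 - N0) by ring.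
rewrite (le_trans (ler_normB _ _)) // (le_trans (lerD (ler_normD _ _) H)) //.
rewrite [`|r * (2 * _)|]normrM [`|r * (r * _)|]normrM [`|2 * _|]normrM [`|r * I h|]normrM.
rewrite normr_nat.
have : `|r| * (`|r| * `|I h|) <= `|r| * `|I h|.
  by rewrite ler_wpM2l // ler_piMl.
lra.
Qed.

(** The strict signs of [P] at [(1 + eta) z] and [(1 - eta) z] survive the perturbation [t h] when
    [t] is small against them. Continuity in [s] is the Lipschitz bound for [P] in the direction [z]
    at each perturbed point. *)
Lemma nehari_intersection z h (eta t Cp Cm : R) : inX z -> inX h -> 0 < eta ->
  (forall r : R, `|r| <= 1 ->
    `|P (Xaxpy (scaled z (1 + eta)) r h) - P (scaled z (1 + eta))| <= Cp * `|r|) ->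
  (forall r : R, `|r| <= 1 ->
    `|P (Xaxpy (scaled z (1 - eta)) r h) - P (scaled z (1 - eta))| <= Cm * `|r|) ->
  `|t| <= 1 -> Cp * `|t| < - P (scaled z (1 + eta)) -> Cm * `|t| < P (scaled z (1 - eta)) ->
  exists s, 1 - eta <= s <= 1 + eta /\ P (Xaxpy (scaled z s) t h) = 0.
Proof.
move=> iz ih e0 hp hm t1 tp tm.
have up := dist_lt_opp (hp t t1) tp; have um := dist_lt_pos (hm t t1) tm.
apply: (@IVT_decreasing R (fun s => P (Xaxpy (scaled z s) t h)) eta e0 _ um up).
apply: locally_lipschitz_continuous => s.
have [C [C0 hC]] := P_lipschitz (inX_axpy t (inX_scaled s iz) ih) iz.
exists C; split; first exact: C0.
move=> r r1; have E : Xaxpy (Xaxpy (scaled z s) t h) r z = Xaxpy (scaled z (s + r)) t h.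
  by rewrite XaxpyDl /scaled addrAC.
by have := hC r r1; rewrite E; exact.
Qed.

(** The order of choices matters: [C] comes from [J_taylor] before [eta], and [t] is chosen after
    [eta]. With [t <= eta] and [|s - 1| <= eta] the error is at most [2 C t eta], which is divided
    by [t]. *)
Lemma Jderiv_small z h : inX z -> inX h -> nonzeroX z -> P z = 0 ->
  (forall w, inX w -> nonzeroX w -> P w = 0 -> J z <= J w) ->
  exists C, 0 <= C /\ forall eta : R, 0 < eta <= 2^-1 ->
    `|Jderiv a c a2 c2 b b2 om F z h| <= C * (eta + eta).
Proof.
move=> iz ih nz Pz Jmin; have I0 := Iom_gt0 iz nz; have q0 := Q2_gt0 iz nz.
have [C [C0 hC]] := J_taylor a c a2 c2 b b2 om cF F0 ca cb iz ih.
exists C; split; first exact: C0.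
move=> eta eb; have /andP[e0 e2] := eb.
have [Cp [Cp0 hp]] := P_lipschitz (inX_scaled (1 + eta) iz) ih.
have [Cm [Cm0 hm]] := P_lipschitz (inX_scaled (1 - eta) iz) ih.
have pp : 0 < - P (scaled z (1 + eta)).
  by rewrite oppr_gt0; apply: (P_scaled_lt0 iz I0 Pz); rewrite ltrDl.
have pm : 0 < P (scaled z (1 - eta)).
  by apply: (P_scaled_gt0 iz I0 Pz); exact: one_sub_itv.
have q8 : 0 < Q2 z / 8 by rewrite divr_gt0.
(* The last three conditions keep the two signs of [P] and the nonvanishing of the competitor. *)
have [t [t0 te tp tm tq]] := exists_small e0 pp pm q8 Cp0 Cm0 (Q2_ge0 h).
have t1 : t <= 1 by rewrite (le_trans te) // (le_trans e2) // invf_le1 // ler1n.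
suff key (r : R) : `|r| = t ->
    0 <= r * Jderiv a c a2 c2 b b2 om F z h + C * (t * (eta + eta)).
  have kp := key t (ger0_norm (ltW t0)).
  have km := key (- t) (etrans (normrN t) (ger0_norm (ltW t0))).
  exact: (norm_le_of_pm t0 kp km).
move=> rt.
have r1 : `|r| <= 1 by rewrite rt.
have tp' : Cp * `|r| < - P (scaled z (1 + eta)) by rewrite rt.
have tm' : Cm * `|r| < P (scaled z (1 - eta)) by rewrite rt.
have [s [sb Ps]] := nehari_intersection iz ih e0 hp hm r1 tp' tm'.
have [s2 s02 se] := near_one_bounds eb sb.
have s0 : 0 < s by rewrite (lt_le_trans _ s2) // invr_gt0.
have r2 : r ^+ 2 = t ^+ 2 by rewrite -(real_normK (num_real r)) rt.
have iw : inX (Xaxpy (scaled z s) r h) := inX_axpy r (inX_scaled s iz) ih.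
(* Since [s >= 1/2], [Q2] of the competitor is at least [Q2 z / 8 - t^2 Q2 h], and [t^2 <= t]. *)
have nw : nonzeroX (Xaxpy (scaled z s) r h).
  apply: (nonzeroX_Q2 iw); apply: lt_le_trans (Q2_axpy_ge s r iz ih).
  rewrite r2 subr_gt0; apply: lt_le_trans (eighth_le s2 (ltW q0)).
  apply: le_lt_trans tq.
  by rewrite expr2 mulrC mulrA ler_piMr // mulr_ge0 ?Q2_ge0 // ltW.
apply: (le_combine (hC s r s02 r1) _ (Jmin _ iw nw Ps) (J_scaled_le iz I0 Pz s0)).
rewrite ler_wpM2l // r2 rt expr2 -mulrDr ler_wpM2l ?(ltW t0) //.
exact: lerD.
Qed.

Lemma Jderiv_eq0 z h : inX z -> inX h -> nonzeroX z -> P z = 0 ->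
  (forall w, inX w -> nonzeroX w -> P w = 0 -> J z <= J w) ->
  Jderiv a c a2 c2 b b2 om F z h = 0.
Proof.
move=> iz ih nz Pz Jmin; have [C [C0 hC]] := Jderiv_small iz ih nz Pz Jmin.
exact: (eq0_of_norm_le C0 hC).
Qed.

(** [nonzeroX] speaks of [ps] and [vv] alone, so their vanishing has to be passed on to the chosen
    representatives of the derivatives before the integrands can be seen to vanish. *)
Lemma Jderiv_zero z h : inX z -> inX h -> ~ nonzeroX z ->
  Jderiv a c a2 c2 b b2 om F z h = 0.
Proof.
move=> iz ih /contrapT [p0 v0].
have [[Lu [Lu1 [Lu2 [d1 d2]]]] [Lv [Lv1 [Lv2 [e1 e2]]]]] := iz.
have p1 := weak_deriv_zero Lu Lu1 d1 p0; have p2 := weak_deriv_zero Lu1 Lu2 d2 p1.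
have v1 := weak_deriv_zero Lv Lv1 e1 v0; have v2 := weak_deriv_zero Lv1 Lv2 e2 v1.
have all0 := ae_and (ae_and p0 (ae_and p1 p2)) (ae_and v0 (ae_and v1 v2)).
rewrite /Jderiv /bil (_ : intR (bilp _ _ _ _ _ _ _ _ _) = 0); last first.
  rewrite -[RHS]intR0; apply: ae_eq_intR => //.
    exact: integ_measurable (integ_bilp _ _ _ _ _ _ _ iz ih).
  by apply: ae_imp all0 => x [[q0 [q1 q2]] [w0 [w1 w2]]]; rewrite /bilp q0 q1 q2 w0 w1 w2; ring.
rewrite (_ : intR (grad_dot _ _ _) = 0) ?subrr //.
rewrite -[RHS]intR0; apply: ae_eq_intR => //; first exact: measurable_grad_dot.
apply: ae_imp all0 => x [[q0 [q1 q2]] [w0 [w1 w2]]]; rewrite /grad_dot big1 // => i _.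
have -> : jet z x = 0.
  apply/rowP => j; rewrite !mxE q0 q1 w0 w1.
  by case: j => [[|[|[|[|j]]]] hj].
by rewrite (grad0 cF ca) mulr0.
Qed.

End NehariMinimizer.

Unset Implicit Arguments.

Theorem theorem2p5 (R : realType) (a c a2 c2 b b2 om : R)
  (F : 'rV[R]_4 -> R) (z0 : Xrep R) :
  a < 0 -> c < 0 -> 0 < a2 -> 0 < c2 -> 0 < b -> 0 < b2 ->
  0 < `|om| ->
  `|om| < Num.min 1 (Num.min (- a / b) (Num.min (- c / b)
                        (Num.min (a2 / b2) (c2 / b2)))) ->
  C2 F -> F 0 = 0 -> cond_a F -> cond_b F -> cond_c F ->
  inX z0 -> Pom a c a2 c2 b b2 om F z0 = 0 ->
  (Jom a c a2 c2 b b2 om F z0)%:E = Som a c a2 c2 b b2 om F ->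
  critical a c a2 c2 b b2 om F z0.
Proof.
move=> _ _ _ _ b0 b20 _; rewrite !lt_min => /and5P[om1 oma omc oma2 omc2].
move=> cF F0 ca cb _ iz Pz JS h ih.
have bound (k l : R) : 0 < k -> `|om| < l / k -> `|om * k| <= l.
  by move=> k0; rewrite ltr_pdivlMr // => hl; rewrite normrM (gtr0_norm k0) ltW.
(* The extended-real infimum enters only as a lower bound, which turns [JS] into an inequality
   between reals. *)
have Jmin w : inX w -> nonzeroX w -> Pom a c a2 c2 b b2 om F w = 0 ->
    Jom a c a2 c2 b b2 om F z0 <= Jom a c a2 c2 b b2 om F w.
  by move=> iw nw Pw; rewrite -lee_fin JS; apply: ereal_inf_lbound; exists w.
apply: (is_derive_eq (J_is_derive a c a2 c2 b b2 om cF F0 ca cb iz ih)).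
have [nz|nz] := pselect (nonzeroX z0); last exact: Jderiv_zero.
exact: (Jderiv_eq0 cF F0 ca cb om1 (bound _ _ b0 oma) (bound _ _ b0 omc)
  (bound _ _ b20 oma2) (bound _ _ b20 omc2) iz ih nz Pz Jmin).
Qed.
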